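(* Given a sequence of points $x_1,x_2,\dots$ of a metric space arriving in an online fashion, there is a stochastic online embedding into an ultrametric (a 2-HST) with expected distortion $O(\mathrm{ddim}\cdot\log\Phi)$, where $\mathrm{ddim}$ and $\Phi$ are the doubling dimension and the aspect ratio of the metric space formed by the points. No prior knowledge (of $\mathrm{ddim}$, $\Phi$, or the number of points) is required.
   Context: An online embedding of a sequence $x_1,\dots,x_k$ of points of a metric space $(X,d_X)$ into a metric space $(Y,d_Y)$ is a sequence of maps $f_1,\dots,f_k$, $f_i:\{x_1,\dots,x_i\}\to Y$, with $f_{i+1}$ extending $f_i$, where $f_i$ may depend only on $x_1,\dots,x_i$. It is dominating if $d_Y(f_k(x_i),f_k(x_j))\ge d_X(x_i,x_j)$ for all $i,j$. A stochastic online embedding is a distribution over dominating online embeddings (the point sequence being fixed in advance, unknown to the algorithm); it has expected distortion $t$ if $\mathbb{E}[d_Y(f_k(x_i),f_k(x_j))]\le t\cdot d_X(x_i,x_j)$ for all $i,j$. A metric $(U,d_U)$ is a $k$-HST if there is a bijection $\varphi$ from $U$ to the leaves of a rooted tree $T$ whose nodes $v$ carry labels $\Gamma(v)\ge0$ with $\Gamma(v)=0$ for leaves, $\Gamma(v)\ge k\,\Gamma(u)$ for every internal node $v$ and child $u$, and $d_U(x,y)=\Gamma(\mathrm{lca}(\varphi(x),\varphi(y)))$; every $k$-HST is an ultrametric. The aspect ratio is the ratio of maximum to minimum nonzero distance. A metric has doubling dimension $\mathrm{ddim}$ if every ball of radius $2r$ can be covered by $2^{\mathrm{ddim}}$ balls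 of radius $r$.
   Formalization: The distortion bound is read as O(ddim·log max(2,Φ)): with Φ = 1 (e.g. two points at distance 1) the literal bound O(ddim·log Φ) is 0, while a dominating embedding has distortion at least 1; for Φ ≥ 2 nothing changes. *)

(* Defs.v *)
From HB Require Import structures.
From mathcomp Require Import all_boot all_order all_algebra.
From mathcomp Require Import all_classical all_reals all_analysis.

Set Implicit Arguments.
Unset Strict Implicit.
Unset Printing Implicit Defensive.

Import Order.TTheory GRing.Theory Num.Theory.
Import numFieldNormedType.Exports.

Local Open Scope classical_set_scope.
Local Open Scope ring_scope.

(* The parent of the root is the root itself. *)
Record rooted_tree := RootedTree {
  node :> finType;
  root : node;
  parent : node -> node;
  parent_root : parent root = root;
  connect_root : forall v, fconnect parent v root }.

Section Tree.
Variable T : rooted_tree.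
Implicit Types u v w : T.

Definition child v u : bool := (u != root T) && (parent u == v).

Definition leaf v : bool := [forall u, ~~ child v u].

Definition ancestor v u : bool := fconnect (@parent T) u v.

Definition is_lca u v w : bool :=
  [&& ancestor w u, ancestor w v &
      [forall z, ancestor z u && ancestor z v ==> ancestor z w]].

(* The default value is never used: two nodes always have a unique lca. *)
Definition lca u v : T := odflt (root T) [pick w | is_lca u v w].

End Tree.

Section Metric.
Variable R : realType.

Definition ultrametric (Y : metricType R) : Prop :=
  forall x y z : Y, mdist x z <= Num.max (mdist x y) (mdist y z).

(* The metric subspace U of Y is a finite kappa-HST. *)
Definition is_HST (kappa : R) (Y : metricType R) (U : set Y) : Prop :=
  exists (T : rooted_tree) (Gamma : T -> R) (phi : Y -> T),
    [/\ forall v, 0 <= Gamma v,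
        forall v, leaf v -> Gamma v = 0,
        forall v u, child v u -> kappa * Gamma u <= Gamma v,
        set_bij U [set v | leaf v] phi &
        forall x y, U x -> U y -> mdist x y = Gamma (lca (phi x) (phi y))].

Section Points.
Variable X : metricType R.
Implicit Types S : set X.

(* The aspect ratio of a finite set with at least two points. *)
Definition aspect_ratio S : R :=
  sup [set r | exists p q, [/\ S p, S q & r = mdist p q]] /
  inf [set r | exists p q, [/\ S p, S q, p <> q & r = mdist p q]].

(* Closed balls of the subspace S, with centers in S. The exponent ddim is
   real, and any valid exponent is allowed, not only the smallest one. *)
Definition has_doubling_dimension S (ddim : R) : Prop :=
  forall (c : X) (r : R), S c -> 0 < r ->
    exists s : seq X,
      [/\ (size s)%:R <= 2 `^ ddim,
          forall p, p \in s -> S p &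
          forall q, S q -> mdist c q <= 2 * r ->
            exists2 p, p \in s & mdist p q <= r].

Variable x : nat -> X.

Definition prefix_set (k : nat) : set X := [set x i | i in `I_k].

Definition distance_mx (k : nat) : 'M[R]_k := \matrix_(i, j) mdist (x i) (x j).

Variable Y : metricType R.

(* [f k i] is the image of [x i] under the k-th map, whose domain is the set
   [prefix_set k]; since that map is indexed by positions in the sequence, it
   must give the same value to equal points. *)
Definition online_embedding (f : forall k : nat, 'I_k -> Y) : Prop :=
  (forall k (i j : 'I_k), x i = x j -> f k i = f k j) /\
  (forall k (i : 'I_k), f k.+1 (widen_ord (leqnSn k) i) = f k i).

Definition dominating (f : forall k : nat, 'I_k -> Y) : Prop :=
  forall k (i j : 'I_k), mdist (x i) (x j) <= mdist (f k i) (f k j).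

End Points.

(* At time k, the algorithm sees the pairwise distances of the first k points
   (and nothing else) and a random outcome, drawn once and for all
   independently of the sequence. *)
Definition online_algorithm (Omega : Type) (Y : metricType R) : Type :=
  forall k : nat, 'M[R]_k -> Omega -> 'I_k -> Y.

Definition run (Omega : Type) (X Y : metricType R)
    (A : online_algorithm Omega Y) (x : nat -> X) (w : Omega) :
    forall k : nat, 'I_k -> Y :=
  fun k => A k (distance_mx x k) w.

End Metric.

Arguments run {R Omega X Y} A x w k _.

(* Main.v *)
Require Import Defs.
From HB Require Import structures.
From mathcomp Require Import all_boot all_order all_algebra.
From mathcomp Require Import all_classical all_reals all_analysis.
From mathcomp Require Import measurable_realfun zify ring lra.

Import Order.TTheory GRing.Theory Num.Theory.
Import numFieldNormedType.Exports.

Local Open Scope classical_set_scope.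
Local Open Scope ring_scope.

Set Implicit Arguments.
Unset Strict Implicit.
Unset Printing Implicit Defensive.

(** At each dyadic scale [r = 2 ^ s], [s] in [int], the points are clustered around the
    greedy [r]-net in order of arrival: a point joins the first net point [t] whose
    random radius, in [[r, 2r]], reaches it. The radius of [t] is truncated exponential
    with rate [2 ln (N + 2)], where [N] counts the earlier net points within [6r] of
    [t]; this is what replaces the knowledge of [ddim]. The truncation errors
    [1 / (N + 2) ^ 2] are summable over the net points near a given pair, and [N] is
    at most [2 ^ (4 ddim)], so two points at distance [delta <= r] are separated with
    probability [O(ddim * delta / r)].

    A point is mapped to the sequence of its cluster labels at all scales, and the
    distance of two labelings is [8 * 2 ^ s] for the largest scale [s] at which they
    differ. Above the diameter the first point captures everything, so that only
    [O(log Phi)] scales contribute to the expectation, each [O(ddim * delta)].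

    All radii are computed from a single uniform number [w]: the coin of [t] is the
    fractional part of [B_t w], where [B_t] is the product of the radices of the
    earlier points. That an earlier point captures neither point of a pair only
    constrains, up to a negligible error, the leading digit of its coin, and these
    digits are independent of the coin of [t]. *)

(** * Finite ultrametrics with geometrically growing distances are HSTs *)

Section LevelTree.
Variables (R : realType) (Y : metricType R) (kappa : R) (n L : nat).
Variables (f : 'I_n.+1 -> Y) (G : nat -> R).
Hypothesis Yu : ultrametric Y.
Hypothesis kappa_ge1 : 1 <= kappa.
Hypothesis G0 : G 0 = 0.
Hypothesis G_ge0 : forall l, 0 <= G l.
Hypothesis G_step : forall l, kappa * G l <= G l.+1.
Hypothesis f_level : forall i j, exists2 l, (l <= L)%N & mdist (f i) (f j) = G l.

Let close l i j := mdist (f i) (f j) <= G l.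

Lemma level_le l m : (l <= m)%N -> G l <= G m.
Proof.
move=> /subnK <-; elim: (m - l)%N => // k IH; rewrite addSn.
by rewrite (le_trans IH)// (le_trans _ (G_step _))// ler_peMl.
Qed.

Let close_refl l i : close l i i.
Proof. by rewrite /close mdistxx. Qed.

Let close_sym l i j : close l i j -> close l j i.
Proof. by rewrite /close metric_sym. Qed.

Let close_trans l i j k : close l i j -> close l j k -> close l i k.
Proof.
rewrite /close => ij jk.
by rewrite (le_trans (Yu _ (f j) _))// ge_max ij jk.
Qed.

(** In an ultrametric, closeness at level [l] is an equivalence relation; the least index of a class
    is its canonical name, so that equality of clusters is equality of indices. *)
Definition level_rep l i : 'I_n.+1 := [arg min_(j < i | close l j i) (j : nat)].

Let close_rep l i : close l (level_rep l i) i.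
Proof. by rewrite /level_rep; case: arg_minnP => //; exact: close_refl. Qed.

Let rep_min l i j : close l j i -> (level_rep l i <= j)%N.
Proof.
rewrite /level_rep; case: arg_minnP => [|k _ mink]; first exact: close_refl.
exact: mink.
Qed.

Let rep_close l i j : close l i j -> level_rep l i = level_rep l j.
Proof.
move=> ij; apply/val_inj/eqP => /=; rewrite eqn_leq; apply/andP; split.
  by apply: rep_min; exact: close_trans (close_rep l j) (close_sym ij).
by apply: rep_min; exact: close_trans (close_rep l i) ij.
Qed.

Let rep_leK l m i : (l <= m)%N -> level_rep m (level_rep l i) = level_rep m i.
Proof. by move=> lm; apply/rep_close/(le_trans (close_rep l i))/level_le. Qed.

Let closeL i j : close L i j.
Proof. by have [l lL eq_l] := f_level i j; rewrite /close eq_l level_le. Qed.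

(* A node is a cluster at level [l] named by its least index; keeping the level in
   the node allows chains of single children, so all leaves are at level 0. *)
Definition tree_node := {p : 'I_L.+1 * 'I_n.+1 | level_rep p.1 p.2 == p.2}.

Fact tree_nodeP (l : 'I_L.+1) i :
  level_rep (l, level_rep l i).1 (l, level_rep l i).2 == (l, level_rep l i).2.
Proof. by rewrite /= rep_leK. Qed.

(** Levels are capped at [L], so that going up from the root gives the root again. *)
Definition lev l : 'I_L.+1 := inord (minn l L).

Let levE l : lev l = minn l L :> nat.
Proof. by rewrite inordK// ltnS geq_minr. Qed.

Let mk l i : tree_node := Sub (lev l, level_rep (lev l) i) (tree_nodeP (lev l) i).

Let level (v : tree_node) : nat := (val v).1.

Let level_mk l i : level (mk l i) = minn l L. Proof. exact: levE. Qed.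

Let levK (l : 'I_L.+1) : lev l = l.
Proof. by apply/val_inj; rewrite /= levE; apply/minn_idPl; rewrite -ltnS. Qed.

Let mkE v : v = mk (level v) (val v).2.
Proof.
apply/val_inj => /=; rewrite levK; case: v => -[l i] /= /eqP ri.
by rewrite ri.
Qed.

Let level_leL v : (level v <= L)%N. Proof. by rewrite -ltnS; exact: ltn_ord. Qed.

Let mk_eq l m i j : minn l L = minn m L -> close (minn l L) i j -> mk l i = mk m j.
Proof.
move=> lm ij; apply/val_inj => /=.
have -> : lev m = lev l by apply/val_inj; rewrite /= !levE lm.
by rewrite (@rep_close (lev l) i j)// levE.
Qed.

Let mk_inj l m i j : mk l i = mk m j ->
  minn l L = minn m L /\ close (minn l L) i j.
Proof.
move=> /(congr1 val)/pair_equal_spec[/= ll' rij].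
have lm : minn l L = minn m L by rewrite -!levE ll'.
split => //; rewrite -levE; apply: (close_trans (close_sym (close_rep _ _))).
by rewrite rij -ll'; exact: close_rep.
Qed.

Let root0 := mk L ord0.

Let mkL i : mk L i = root0. Proof. by apply: mk_eq => //; rewrite minnn. Qed.

Definition tree_parent (v : tree_node) : tree_node := mk (level v).+1 (val v).2.

Let parent_mk l i : tree_parent (mk l i) = mk l.+1 i.
Proof.
rewrite /tree_parent level_mk; apply: mk_eq => /=; first by lia.
apply: (le_trans (close_rep _ _)); apply: level_le; rewrite levE; lia.
Qed.

Let iter_parent m l i : iter m tree_parent (mk l i) = mk (l + m) i.
Proof. by elim: m => [|m IH] /=; rewrite ?addn0// IH parent_mk addnS. Qed.

Let tree_parent_root : tree_parent root0 = root0.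
Proof. by rewrite parent_mk -(mkL ord0); apply: mk_eq => //; lia. Qed.

Let tree_connect_root v : fconnect tree_parent v root0.
Proof.
have -> : root0 = iter L tree_parent v; last exact: fconnect_iter.
rewrite (mkE v) iter_parent -(mkL (val v).2).
by apply: mk_eq => //; lia.
Qed.

Definition level_tree := RootedTree tree_parent_root tree_connect_root.

Let ancestorP w l i :
  reflect (exists2 m, (l <= m)%N & w = mk m i) (@ancestor level_tree w (mk l i)).
Proof.
apply: (iffP idP) => [/iter_findex <-|[m /subnKC <- ->]].
  by exists (l + findex tree_parent (mk l i) w)%N; [lia|rewrite iter_parent].
by rewrite /ancestor -iter_parent; exact: fconnect_iter.
Qed.

Let child_level (v u : level_tree) : child v u -> level v = (level u).+1.
Proof.
rewrite /child => /andP[uroot /eqP <-]; rewrite [parent _]/(mk _ _) level_mk.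
suff : (level u < L)%N by lia.
rewrite ltn_neqAle level_leL andbT; apply: contra uroot => /eqP uL.
by rewrite (mkE u) uL mkL.
Qed.

Let leafE (v : level_tree) : leaf v = (level v == 0)%N.
Proof.
apply/forallP/eqP => [|v0 u]; last first.
  by apply/negP => /child_level; rewrite v0.
move=> Hv; case lv : (level v) => [|l] //.
have pE : @parent level_tree (mk l (val v).2) = mk l.+1 (val v).2 by exact: parent_mk.
have := Hv (mk l (val v).2); rewrite /child pE -lv -mkE eqxx andbT.
move=> /negPn/eqP/(congr1 level); rewrite !level_mk.
by have := level_leL v; lia.
Qed.

Let phi (y : Y) : level_tree :=
  if [pick i | f i == y] is Some i then mk 0 i else root0.

Let phiE i : phi (f i) = mk 0 i.
Proof.
rewrite /phi; case: pickP => [j /eqP fji|/(_ i)]; last by rewrite eqxx.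
by apply: mk_eq => //; rewrite min0n /close fji mdistxx G0.
Qed.

(** The ancestors of the leaf of [i] are its clusters at all levels, and such a cluster contains [j]
    exactly from the first level at which [i] and [j] are close. *)
Let lca_mk i j l : (l <= L)%N -> close l i j ->
  (forall m, close m i j -> (l <= m)%N) ->
  @lca level_tree (mk 0 i) (mk 0 j) = mk l i.
Proof.
move=> lL clij minl.
have lcaP : @is_lca level_tree (mk 0 i) (mk 0 j) (mk l i).
  apply/and3P; split.
  - by apply/ancestorP; exists l.
  - by apply/ancestorP; exists l => //; apply: mk_eq => //; rewrite (minn_idPl lL).
  - apply/forallP => z; apply/implyP => /andP[/ancestorP[m _ ->]].
    move=> /ancestorP[m' _ /mk_inj[_ /minl lm]]; apply/ancestorP.
    by exists m => //; lia.
rewrite /lca; case: pickP => [w|/(_ (mk l i))]; last by rewrite lcaP.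
move=> /and3P[/ancestorP[m _ ->] /ancestorP[m' _ /mk_inj[_ /minl lm]]].
move=> /forallP/(_ (mk l i)); have /and3P[-> -> _] := lcaP.
move=> /ancestorP[m'' mm'' /mk_inj[e _]].
by apply: mk_eq; [lia|rewrite /close mdistxx].
Qed.

Lemma is_HST_levels : is_HST kappa (range f).
Proof.
exists level_tree, (fun v => G (level v)), phi; split.
- by move=> v; exact: G_ge0.
- by move=> v; rewrite leafE => /eqP ->.
- by move=> v u /child_level ->; exact: G_step.
- split.
  + by move=> _ [i _ <-]; rewrite /= phiE leafE level_mk min0n.
  + move=> _ _ /set_mem[i _ <-] /set_mem[j _ <-].
    rewrite !phiE => /mk_inj[_]; rewrite min0n /close G0 => d0.
    by apply: mdist_positivity; apply/le_anti; rewrite d0 mdist_ge0.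
  + move=> v /=; rewrite leafE => /eqP v0.
    exists (f (val v).2); first by exists (val v).2.
    by rewrite phiE -v0 -mkE.
- move=> _ _ [i _ <-] [j _ <-]; rewrite !phiE.
  have [l0 l0L dE] := f_level i j.
  have exl : exists l, close l i j by exists l0; rewrite /close dE.
  (* Several levels may share a value of [G], and the lca sits at the least one where [i] and [j]
     are close. There [G] still equals the distance, being squeezed between it and [G l0]. *)
  case: (ex_minnP exl) => l lij lmin.
  have ll0 : (l <= l0)%N by apply: lmin; rewrite /close dE.
  rewrite (lca_mk (leq_trans ll0 l0L) lij lmin) level_mk (minn_idPl (leq_trans ll0 l0L)).
  by apply/le_anti; rewrite [_ <= _]lij dE level_le.
Qed.

End LevelTree.

(** * The ultrametric of labelings of the dyadic scales *)

Definition labeling :=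
  {y : int -> nat | `[< exists N : int, forall i, N <= i -> y i = 0%N >]}.

HB.instance Definition _ := Choice.on labeling.

Section LabelMetric.
Variable R : realType.
Implicit Types y z : labeling.

(* The supremum of the empty set is 0, so this also covers [y = z]. *)
Definition ldist y z : R :=
  sup [set r | exists2 i : int, val y i <> val z i & r = 8 * 2 ^ i].

Lemma ler_exp2z (i j : int) : i <= j -> 2 ^ i <= 2 ^ j :> R.
Proof. by apply: ler_weXz2l; rewrite ler1n. Qed.

Lemma exp2z_gt0 (i : int) : 0 < 2 ^ i :> R.
Proof. by rewrite exprz_gt0. Qed.

(** Both labelings vanish at large scales, so the scales at which they differ are bounded above, and
    a downward search from a common bound finds the largest one. *)
Lemma labeling_neq_top y z : y <> z -> exists i : int,
  val y i <> val z i /\ forall j, i < j -> val y j = val z j.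
Proof.
move=> yz.
have [N HN] : exists N : int, forall j, N <= j -> val y j = val z j.
  have /asboolP[N1 H1] := valP y; have /asboolP[N2 H2] := valP z.
  exists (Num.max N1 N2) => j; rewrite ge_max => /andP[j1 j2].
  by rewrite H1// H2.
have [i Hi] : exists i : int, val y i != val z i.
  apply/not_existsP => H; apply/yz/val_inj/funext => i.
  by apply/eqP/negPn/negP => /H.
have exm : exists m : nat, val y (N - m%:Z) != val z (N - m%:Z).
  exists `|N - i|%N; rewrite gez0_abs; first by rewrite subKr.
  by rewrite subr_ge0 leNgt; apply: contra Hi => /ltW /HN ->.
case: (ex_minnP exm) => m Hm minm; exists (N - m%:Z); split; first exact/eqP.
move=> j Hj; apply/eqP/negPn/negP => yzj.
have [Nj|jN] := leP N j; first by rewrite HN ?eqxx// in yzj.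
have : (m <= `|N - j|)%N.
  by apply: minm; rewrite gez0_abs ?subKr// subr_ge0 ltW.
lia.
Qed.

Lemma ldistE y z i : val y i <> val z i ->
  (forall j, i < j -> val y j = val z j) -> ldist y z = 8 * 2 ^ i.
Proof.
move=> yzi itop.
have ub : ubound [set r | exists2 i : int, val y i <> val z i & r = 8 * 2 ^ i :> R]
    (8 * 2 ^ i).
  move=> _ [j yzj ->]; rewrite ler_pM2l//; apply: ler_exp2z.
  by rewrite leNgt; apply/negP => /itop.
apply/le_anti/andP; split; first by apply: ge_sup => //; exists (8 * 2 ^ i), i.
by apply: ub_le_sup; [exists (8 * 2 ^ i)|exists i].
Qed.

Lemma ldistxx y : ldist y y = 0.
Proof.
rewrite /ldist; set A := [set _ | _]; suff -> : A = set0 by rewrite sup0.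
by rewrite -subset0 => r [].
Qed.

Lemma ldist_ge y z i : val y i <> val z i -> 8 * 2 ^ i <= ldist y z.
Proof.
move=> yzi.
have [k [yzk ktop]] : exists i : int,
    val y i <> val z i /\ forall j, i < j -> val y j = val z j.
  by apply: labeling_neq_top => yz; rewrite yz in yzi.
rewrite (ldistE yzk ktop) ler_pM2l//; apply: ler_exp2z.
by rewrite leNgt; apply/negP => /ktop.
Qed.

Lemma ldist_le y z c : 0 <= c ->
  (forall i, val y i <> val z i -> 8 * 2 ^ i <= c) -> ldist y z <= c.
Proof.
move=> c0 H; have [->|/eqP yz] := eqVneq y z; first by rewrite ldistxx.
have [k [yzk ktop]] := labeling_neq_top yz.
by rewrite (ldistE yzk ktop) H.
Qed.

Lemma ldist_ge0 y z : 0 <= ldist y z.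
Proof.
have [->|/eqP yz] := eqVneq y z; first by rewrite ldistxx.
have [k [yzk ktop]] := labeling_neq_top yz.
by rewrite (ldistE yzk ktop) mulr_ge0// ltW// exp2z_gt0.
Qed.

Lemma ldist_eq0 y z : ldist y z = 0 -> y = z.
Proof.
have [->//|/eqP yz] := eqVneq y z.
have [k [yzk ktop]] := labeling_neq_top yz.
by rewrite (ldistE yzk ktop) => /eqP; rewrite gt_eqF// mulr_gt0// exp2z_gt0.
Qed.

Lemma ldist_sym y z : ldist y z = ldist z y.
Proof.
by congr sup; apply/seteqP; split => r [i yzi ->]; exists i => // /esym.
Qed.

Lemma ldist_ultra x y z : ldist x z <= Num.max (ldist x y) (ldist y z).
Proof.
apply: ldist_le => [|i xzi]; first by rewrite le_max ldist_ge0.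
rewrite le_max; have [xyi|/eqP/ldist_ge ->//] := eqVneq (val x i) (val y i).
by rewrite xyi in xzi; rewrite (ldist_ge xzi) orbT.
Qed.

Lemma ldist_triangle y x z : ldist x z <= ldist x y + ldist y z.
Proof.
rewrite (le_trans (ldist_ultra x y z))// ge_max.
by rewrite lerDl lerDr !ldist_ge0.
Qed.

HB.instance Definition _ := @isMetric.Build R labeling ldist
  ldistxx ldist_eq0 ldist_sym ldist_triangle.

Definition labeling_metric : metricType R := labeling.

Lemma labeling_ultrametric : ultrametric labeling_metric.
Proof. exact: ldist_ultra. Qed.

Lemma mdist_labeling (y z : labeling_metric) : mdist y z = ldist y z.
Proof. by []. Qed.

End LabelMetric.

(** * Online clustering at one scale *)

Section Clustering.
Variable R : realType.
Implicit Types (d : nat -> nat -> R) (r w : R).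

Fixpoint net d r n : seq nat :=
  if n is m.+1 then
    if all (fun c => r < d c m) (net d r m) then rcons (net d r m) m
    else net d r m
  else [::].

(** Net points able to capture one of two points at distance at most [r] lie within [3 * r] of
    either of them, hence within [6 * r] of each other. *)
Definition crowd d r t : nat := count (fun c => d c t <= 6 * r) (net d r t).

(** Chosen so that the truncated tail [expR (- rate d r t)] is [1 / (crowd + 2)^2]. *)
Definition rate d r t : R := 2 * ln (crowd d r t).+2%:R.

(* Distribution function at [d t j] of an exponential radius of rate [rate d r t / r],
   shifted by [r] and conditioned to be at most [2 * r]. *)
Definition threshold d r t j : R :=
  (1 - expR (- rate d r t * Num.max 0 (d t j / r - 1))) / (1 - expR (- rate d r t)).

(* [radix t] is at least [(crowd d r t).+2 ^ 2], the inverse of the truncation error: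
   the leading base-[radix t] digit of the coin then determines the failure of [t] to
   capture up to an error of the order of the truncation error. *)
Definition radix t : nat := t.+2 ^ 2.

Definition radix_prod t : nat := \prod_(s < t) radix s.

Definition fracr w : R := w - (Num.floor w)%:~R.

Definition coin t w : R := fracr ((radix_prod t)%:R * w).

(** Inverse transform sampling: the random radius reaches [d t j] exactly when the uniform coin
    reaches the distribution function at [d t j]. *)
Definition captures d r w j t : bool := threshold d r t j <= coin t w.

Definition cluster d r w j : nat := head 0%N [seq t <- net d r j.+1 | captures d r w j t].

Lemma fracr_itv w : 0 <= fracr w < 1.
Proof.
by rewrite /fracr subr_ge0 floor_le_tmp ltrBlDl -intrD1 floorD1_gt.
Qed.

Lemma mem_net d r n t :
  (t \in net d r n) = (t < n)%N && all (fun c => r < d c t) (net d r t).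
Proof.
elim: n => [|n IH]; first by rewrite ltn0.
rewrite /= ltnS leq_eqVlt; case: ifPn => Hn; rewrite ?mem_rcons ?inE IH.
  by case: eqVneq => [->|//]; rewrite Hn.
by case: eqVneq => [->|//]; rewrite ltnn (negbTE Hn).
Qed.

Lemma net_cat d r m n : (m <= n)%N -> exists s, net d r n = net d r m ++ s.
Proof.
move=> /subnK <-; elim: (n - m)%N => [|k [s IH]]; first by exists [::]; rewrite cats0.
rewrite addSn /=; case: ifP => _; last by exists s.
by exists (rcons s (k + m)%N); rewrite IH rcons_cat.
Qed.

Lemma net_uniq d r n : uniq (net d r n).
Proof.
elim: n => //= n IH; case: ifP => // _.
by rewrite rcons_uniq IH andbT mem_net ltnn.
Qed.

Lemma net_ext d d' r n : (forall a b, (a < n)%N -> (b < n)%N -> d a b = d' a b) ->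
  net d r n = net d' r n.
Proof.
elim: n => //= n IH dd.
have -> : net d r n = net d' r n by apply: IH => a b an bn; rewrite dd// ltnW.
have -> // : all (fun c => r < d c n) (net d' r n) = all (fun c => r < d' c n) (net d' r n).
by apply: eq_in_all => c; rewrite mem_net => /andP[cn _]; rewrite dd// ltnW.
Qed.

Lemma crowd_ext d d' r t : (forall a b, (a <= t)%N -> (b <= t)%N -> d a b = d' a b) ->
  crowd d r t = crowd d' r t.
Proof.
move=> dd; rewrite /crowd (@net_ext d d' r t).
  by apply: eq_in_count => c; rewrite mem_net => /andP[/ltnW cn _]; rewrite dd.
by move=> a b /ltnW ? /ltnW ?; rewrite dd.
Qed.

(** This is what makes the clustering online: the label of [j] is computed from the distances among
    the points up to [j]. *)
Lemma cluster_ext d d' r w j : (forall a b, (a <= j)%N -> (b <= j)%N -> d a b = d' a b) ->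
  cluster d r w j = cluster d' r w j.
Proof.
move=> dd.
have netE : net d r j.+1 = net d' r j.+1.
  by apply: net_ext => a b; rewrite !ltnS => *; exact: dd.
have captE : {in net d' r j.+1, captures d r w j =1 captures d' r w j}.
  move=> t; rewrite mem_net => /andP[tj _].
  have Ec : crowd d r t = crowd d' r t.
    by apply: crowd_ext => a b at_ bt; apply: dd; lia.
  have Ed : d t j = d' t j by apply: dd.
  by rewrite /captures /threshold /rate Ec Ed.
by rewrite /cluster netE (eq_in_filter captE).
Qed.

Lemma crowd_le d r t : (crowd d r t <= t)%N.
Proof.
rewrite /crowd (leq_trans (count_size _ _))//.
by elim: t => //= t IH; case: ifP => _; rewrite ?size_rcons//; exact: leq_trans IH _.
Qed.

Lemma expR_rate d r t : expR (- rate d r t) = ((crowd d r t).+2 ^ 2)%:R^-1.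
Proof.
by rewrite expRN /rate mulr_natl -lnXn ?ltr0n// lnK ?natrX// posrE exprn_gt0// ltr0n.
Qed.

Lemma rate_gt0 d r t : 0 < rate d r t.
Proof. by rewrite mulr_gt0// ln_gt0// ltr1n. Qed.

Lemma expR_rate_lt1 d r t : 0 < 1 - expR (- rate d r t).
Proof. by rewrite subr_gt0 expR_lt1 oppr_lt0 rate_gt0. Qed.

Lemma threshold_ge0 d r t j : 0 <= threshold d r t j.
Proof.
apply: divr_ge0; last exact/ltW/expR_rate_lt1.
rewrite subr_ge0 -[leRHS]expR0 ler_expR mulNr oppr_le0.
by apply: mulr_ge0; [exact/ltW/rate_gt0|rewrite le_max lexx].
Qed.

Lemma threshold_near d r t j : 0 < r -> d t j <= r -> threshold d r t j = 0.
Proof.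
move=> r0 dr; rewrite /threshold max_l ?mulr0 ?expR0 ?subrr ?mul0r//.
by rewrite subr_le0 ler_pdivrMr// mul1r.
Qed.

Lemma threshold_lt1 d r t j : 0 < r -> threshold d r t j < 1 -> d t j < 2 * r.
Proof.
move=> r0; rewrite /threshold ltr_pdivrMr ?expR_rate_lt1// mul1r.
rewrite ltrD2l ltrN2 ltr_expR mulNr ltrN2 gtr_pMr ?rate_gt0//.
by rewrite gt_max ltrBlDr -[1 + 1]/(2%:R) ltr_pdivrMr// => /andP[].
Qed.

Lemma threshold_le d r t i j : 0 < r -> d t i <= d t j ->
  threshold d r t i <= threshold d r t j.
Proof.
move=> r0 dij; rewrite /threshold ler_pM2r ?invr_gt0 ?expR_rate_lt1//.
rewrite lerD2l lerN2 ler_expR !mulNr lerN2 ler_pM2l ?rate_gt0//.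
rewrite ge_max le_max lexx /= le_max lerD2r ler_pM2r ?invr_gt0// dij.
by rewrite orbT.
Qed.

Lemma coin_itv t w : 0 <= coin t w < 1. Proof. exact: fracr_itv. Qed.

Lemma captures_near d r w t j : 0 < r -> d t j <= r -> captures d r w j t.
Proof.
move=> r0 dr; rewrite /captures threshold_near//.
by have /andP[] := coin_itv t w.
Qed.

Lemma captures_lt d r w t j : 0 < r -> captures d r w j t -> d t j < 2 * r.
Proof.
move=> r0 Ht; apply: threshold_lt1 => //; apply: le_lt_trans Ht _.
by have /andP[] := coin_itv t w.
Qed.

(** Point [0] heads every nonempty net, and its radius is at least [r] whatever its coin. *)
Lemma cluster_far d r w j : 0 < r -> d 0%N j <= r -> cluster d r w j = 0%N.
Proof.
move=> r0 dj; rewrite /cluster.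
by have [s ->] := @net_cat d r 1 j.+1 isT; rewrite /= captures_near.
Qed.

(** Either [j] is a net point or an earlier net point lies within [r] of it, so some point of
    [net d r j.+1] captures [j] and the default of [head] is never reached. Net points added later
    come after it and leave the label unchanged. *)
Lemma cluster_net d r w j n : 0 < r -> d j j <= r -> (j < n)%N ->
  cluster d r w j = head 0%N [seq t <- net d r n | captures d r w j t] /\
  has (captures d r w j) (net d r n).
Proof.
move=> r0 dj jn.
have Hh : has (captures d r w j) (net d r j.+1).
  have [Hj|/allPn[c cj rc]] := boolP (all (fun c => r < d c j) (net d r j)).
    apply/hasP; exists j; first by rewrite mem_net ltnSn.
    exact: captures_near.
  apply/hasP; exists c; last by apply: captures_near => //; rewrite leNgt.
  by move: cj; rewrite !mem_net => /andP[cj ->]; rewrite ltnS ltnW.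
have [s ->] := @net_cat d r _ _ jn; rewrite has_cat Hh; split => //.
rewrite /cluster filter_cat; move: Hh; rewrite has_filter.
by case: seq.filter.
Qed.

Lemma captures_cluster d r w j : 0 < r -> d j j <= r -> captures d r w j (cluster d r w j).
Proof.
move=> r0 dj; have [-> ] := cluster_net w r0 dj (ltnSn j).
by elim: (net _ _ _) => //= t s IH; case: ifPn.
Qed.

(** Both points lie within [2 * r] of the net point that captures them. *)
Lemma cluster_diam d r w i j : 0 < r ->
  (forall a b, d a b = d b a) -> (forall a b c, d a c <= d a b + d b c) ->
  (forall a, d a a = 0) ->
  cluster d r w i = cluster d r w j -> d i j <= 4 * r.
Proof.
move=> r0 ds dt d0 cij.
have := captures_cluster w r0 (_ : d i i <= r); rewrite d0 => /(_ (ltW r0)).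
have := captures_cluster w r0 (_ : d j j <= r); rewrite d0 => /(_ (ltW r0)).
rewrite -cij => /(captures_lt r0) tj /(captures_lt r0) ti.
have := dt i (cluster d r w i) j; rewrite (ds i (cluster _ _ _ _)); lra.
Qed.

End Clustering.

(** * Mixed radix digits of a uniform number *)

Section DigitProbability.
Variable R : realType.
Implicit Types (w alpha beta : R) (kap : nat -> nat).

Definition unit_law : probability (measurableTypeR R) R := @uniform_prob R 0 1 ltr01.

(** The uniform law is Lebesgue measure on the closed unit interval; the endpoint [1] is a null set,
    so the inclusion is only asked on [[0, 1[], where the digits behave well. *)
Lemma unit_law_le (A B : set R) : measurable A -> measurable B ->
  (forall w, 0 <= w < 1 -> A w -> B w) ->
  (unit_law A <= (@lebesgue_measure R) B)%E.
Proof.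
move=> mA mB AB; rewrite /unit_law /= /uniform_prob integral_uniform_pdf.
have mA1 : measurable (A `&` `[0, 1]%classic : set R) by exact: measurableI.
have -> : (@lebesgue_measure R) B = (@lebesgue_measure R B + @lebesgue_measure R [set 1%R])%E.
  by rewrite lebesgue_measure_set1 adde0.
apply: (@le_trans _ _ (@lebesgue_measure R (B `|` [set 1%R]))); last first.
  by apply: measureU2 => //; exact: measurable_set1.
apply: (@le_trans _ _ (@lebesgue_measure R (A `&` `[0, 1]%classic))).
  rewrite -[leRHS]mul1e -integral_cst//; apply: ge0_le_integral => //.
  - by move=> w _; rewrite lee_fin uniform_pdf_ge0.
  - by apply/measurable_EFinP/measurable_funTS; exact: measurable_uniform_pdf.
  - by move=> w _; rewrite lee_fin /uniform_pdf subr0 invr1; case: ifP.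
apply: le_measure; rewrite ?inE//.
  by apply: measurableU => //; exact: measurable_set1.
move=> w [Aw]; rewrite /= in_itv/= => /andP[w0].
rewrite le_eqVlt => /orP[/eqP ->|w1]; first by right.
by left; apply: AB => //; rewrite w0.
Qed.

Lemma fracrE w n : n%:R <= w < n.+1%:R -> fracr w = w - n%:R.
Proof.
move=> nwn; rewrite /fracr; have -> : Num.floor w = n%:Z.
  by apply: floor_def; rewrite -PoszD addn1 -!pmulrn.
by rewrite -pmulrn.
Qed.

(* Values of the first [t] mixed radix digits whose [s]-th digit is below [kap s]. *)
Fixpoint prefixes kap t : seq nat :=
  if t is s.+1 then [seq (q * radix s + e)%N | q <- prefixes kap s, e <- iota 0 (kap s)]
  else [:: 0%N].

Lemma size_prefixes kap t : size (prefixes kap t) = (\prod_(s < t) kap s)%N.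
Proof.
elim: t => [|t IH]; first by rewrite big_ord0.
by rewrite big_ord_recr /= size_allpairs size_iota IH.
Qed.

(** Multiplication by [radix t] splits [coin t w] into the next digit, its integer part, and the
    next coin, its fractional part. *)
Lemma prefixesP kap t w : 0 <= w < 1 ->
  (forall s, (s < t)%N -> (radix s)%:R * coin s w < (kap s)%:R) ->
  exists2 q, q \in prefixes kap t & (radix_prod t)%:R * w = q%:R + coin t w.
Proof.
move=> w01; elim: t => [|t IH] Hk.
  exists 0%N; first by rewrite inE.
  by rewrite /coin /radix_prod big_ord0 mul1r add0r (@fracrE _ 0) ?subr0.
have [q qP qE] := IH (fun s st => Hk s (ltnW st)).
have prodE : (radix_prod t.+1)%:R * w = (q * radix t)%:R + (radix t)%:R * coin t w.
  rewrite /radix_prod big_ord_recr /= -/(radix_prod t) !natrM mulrAC qE.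
  by rewrite mulrDl [coin t w * _]mulrC.
have c0 : 0 <= (radix t)%:R * coin t w.
  by apply: mulr_ge0 => //; have /andP[] := coin_itv t w.
have /andP[e1 e2] := truncn_itv c0; set e := Num.trunc _ in e1 e2.
exists (q * radix t + e)%N.
  apply/allpairsP; exists (q, e); split => //=.
  by rewrite mem_iota add0n /e truncn_lt_nat// Hk.
rewrite /coin (@fracrE _ (q * radix t + e)); first by rewrite addrC subrK.
by rewrite prodE -addnS !natrD lerD2l ltrD2l e1.
Qed.

Lemma coin_measurable t : measurable_fun setT (@coin R t).
Proof.
rewrite /coin /fracr; apply: measurable_funB.
  by apply: measurable_funM => //; exact: measurable_id.
apply: nondecreasing_measurable => // x y xy.
by rewrite ler_int; apply: le_floor; rewrite ler_wpM2l.
Qed.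

Lemma radix_prod_gt0 t : (0 < radix_prod t)%N.
Proof. by apply: prodn_gt0 => s; rewrite expn_gt0. Qed.

(** Independence of the coin from the earlier digits: each admissible digit string confines [w] to
    an interval of length [(beta - alpha) / radix_prod t], and there are [\prod_(s < t) kap s] such
    strings. *)
Lemma unit_law_digits kap t alpha beta (A : set R) : measurable A -> alpha <= beta ->
  (forall w, A w -> (forall s, (s < t)%N -> (radix s)%:R * coin s w < (kap s)%:R) /\
    alpha <= coin t w < beta) ->
  (unit_law A <= ((\prod_(s < t) ((kap s)%:R / (radix s)%:R)) * (beta - alpha))%:E)%E.
Proof.
move=> mA ab HA.
pose Q := prefixes kap t; pose N : R := (radix_prod t)%:R.
have N0 : 0 < N by rewrite ltr0n radix_prod_gt0.
pose F k : set R := `[((nth 0%N Q k)%:R + alpha) / N, ((nth 0%N Q k)%:R + beta) / N[%classic.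
have mF k : measurable (F k) by exact: measurable_itv.
have muF k : (@lebesgue_measure R (F k) = ((beta - alpha) / N)%:E)%E.
  rewrite /F lebesgue_measure_itv /= lte_fin ltr_pM2r ?invr_gt0// ltrD2l.
  case: ltP => [_|ba]; first by rewrite -EFinB; congr EFin; ring.
  by rewrite (@le_anti _ _ alpha beta) ?ab ?ba// subrr mul0r.
apply: (@le_trans _ _ (@lebesgue_measure R (\big[setU/set0]_(k < size Q) F k))).
  apply: unit_law_le => //; first exact: bigsetU_measurable.
  move=> w w01 /HA[Hk /andP[aw wb]]; have [q qP qE] := prefixesP w01 Hk.
  rewrite -bigcup_mkord; exists (index q Q); first by rewrite /= index_mem.
  rewrite /F /= in_itv/= nth_index// ler_pdivrMr// ltr_pdivlMr// mulrC /N qE.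
  by rewrite lerD2l ltrD2l aw.
apply: (@le_trans _ _ (\sum_(k < size Q) @lebesgue_measure R (F k))%E).
  by apply: Boole_inequality => k _; exact: mF.
under eq_bigr do rewrite muF.
rewrite sumEFin lee_fin big_const_ord iter_addr_0 size_prefixes.
rewrite -mulr_natl prodf_div !natr_prod /N /radix_prod natr_prod.
by rewrite mulrAC mulrA.
Qed.

End DigitProbability.

(** * The probability of separating two points *)

Section CutProbability.
Variable R : realType.

(** The terms are the probabilities that the first success of independent trials with success rates
    [l] occurs at [t]; they telescope. *)
Lemma sum_first_hit (l : nat -> R) n : (forall s, 0 <= l s <= 1) ->
  \sum_(t < n) (\prod_(s < t) (1 - l s)) * l t <= 1.
Proof.
move=> l01; suff -> : \sum_(t < n) (\prod_(s < t) (1 - l s)) * l t =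
    1 - \prod_(s < n) (1 - l s).
  rewrite gerBl; apply: prodr_ge0 => s _; have := l01 s; lra.
elim: n => [|n IH]; first by rewrite !big_ord0 subrr.
by rewrite !big_ord_recr /= IH; ring.
Qed.

(** The [c]-th related index, counting from [0], has [N] at least [c], so the sum is dominated by
    the telescoping series of [1 / ((c + 1) (c + 2))]. *)
Lemma sum_rank (rel : pred nat) (N : nat -> nat) n :
  (forall t, (t < n)%N -> rel t -> (count rel (iota 0 t) <= N t)%N) ->
  \sum_(t < n | rel t) ((N t).+1%:R * (N t).+2%:R)^-1 <= 1 :> R.
Proof.
move=> HN; suff : \sum_(t < n | rel t) ((N t).+1%:R * (N t).+2%:R)^-1 <=
    1 - (count rel (iota 0 n)).+1%:R^-1 :> R.
  by move=> /le_trans; apply; rewrite gerBl invr_ge0.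
elim: n HN => [|n IH] HN; first by rewrite big_ord0 /= invr1 subrr.
have -> : count rel (iota 0 n.+1) = (count rel (iota 0 n) + rel n)%N.
  by rewrite -[n.+1]addn1 iotaD count_cat /= add0n addn0.
rewrite big_mkcond big_ord_recr -big_mkcond /=.
have {IH} := IH (fun t tn => HN t (ltnW tn)).
have := HN n (ltnSn n); case: (rel n) => [/(_ isT) cN IH|_]; last by rewrite addr0 addn0.
rewrite addn1.
set c := count _ _ in cN IH *.
have c1 : 0 < c.+1%:R :> R by rewrite ltr0n.
have : ((N n).+1%:R * (N n).+2%:R)^-1 <= (c.+1%:R * c.+2%:R)^-1 :> R.
  by rewrite lef_pV2 ?posrE ?mulr_gt0 ?ltr0n// -!natrM ler_nat leq_mul// ltnS.
have -> : (c.+1%:R * c.+2%:R)^-1 = c.+1%:R^-1 - c.+2%:R^-1 :> R.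
  have -> : c.+2%:R = c.+1%:R + 1 :> R by rewrite natr1.
  by field; rewrite !gt_eqF// addr_gt0.
by move=> /(lerD IH); rewrite addrA subrK.
Qed.

(** Memorylessness: given that the radius reaches [d t i], it falls short of [d t j] with
    probability at most the rate times the scaled gap. The last summand corrects for the
    truncation. *)
Lemma threshold_gap (d : nat -> nat -> R) r t i j : 0 < r -> d t i <= d t j ->
  threshold d r t j - threshold d r t i <=
  rate d r t * ((d t j - d t i) / r) *
  (1 - threshold d r t i + expR (- rate d r t) / (1 - expR (- rate d r t))).
Proof.
move=> r0 dij; rewrite /threshold.
have := expR_rate_lt1 d r t; have := rate_gt0 d r t; have := expR_gt0 (- rate d r t).
set la := rate d r t; set E := expR (- la) => E0 la0 E1.
set a := Num.max 0 _; set b := Num.max 0 (d t i / r - 1).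
have ba : 0 <= a - b <= (d t j - d t i) / r.
  have : d t i / r <= d t j / r by rewrite ler_pM2r// invr_gt0.
  rewrite /a /b mulrBl; move: (d t i / r) (d t j / r) => x y xy.
  by case: (ltP 0 (y - 1)); case: (ltP 0 (x - 1)) => *; apply/andP; split; lra.
have Eb : expR (- la * a) >= expR (- la * b) * (1 - la * (a - b)).
  have -> : - la * a = - la * b + - (la * (a - b)) by ring.
  by rewrite expRD ler_pM2l ?expR_gt0// expR_ge1Dx.
have Eb0 := expR_gt0 (- la * b).
set x := expR (- la * b) in Eb Eb0 *; set y := expR (- la * a) in Eb *.
have -> : (1 - y) / (1 - E) - (1 - x) / (1 - E) = (x - y) / (1 - E).
  by rewrite -mulrBl; congr (_ / _); ring.
have -> : 1 - (1 - x) / (1 - E) + E / (1 - E) = x / (1 - E).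
  by field; rewrite gt_eqF.
rewrite mulrA ler_pM2r ?invr_gt0//.
have : x * (la * (a - b)) <= x * (la * ((d t j - d t i) / r)).
  by rewrite ler_pM2l// ler_pM2l//; case/andP: ba.
move: Eb; lra.
Qed.

Variables (d : nat -> nat -> R) (r : R) (i j n : nat) (La : R).
Hypothesis d_sym : forall a b, d a b = d b a.
Hypothesis d_triangle : forall a b c, d a c <= d a b + d b c.
Hypothesis d_refl : forall a, d a a = 0.
Hypothesis r_gt0 : 0 < r.
Hypothesis i_lt : (i < n)%N.
Hypothesis j_lt : (j < n)%N.

Let lo t := Num.min (threshold d r t i) (threshold d r t j).
Let hi t := Num.max (threshold d r t i) (threshold d r t j).
(** The net points that can capture [i] or [j] for some value of their coin. *)
Let rel t := (t \in net d r n) && (lo t < 1).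
(* The leading digit of [coin t] is below [kap t] whenever [t] captures neither point. *)
Let kap t := if rel t then (Num.trunc ((radix t)%:R * lo t)).+1 else radix t.
(** The probability that the leading digit of [coin t] is at least [kap t], which forces [t] to
    capture one of the two points. *)
Let loss t : R := 1 - (kap t)%:R / (radix t)%:R.

Let radix_gt0 t : 0 < (radix t)%:R :> R.
Proof. by rewrite ltr0n expn_gt0. Qed.

Let lo_ge0 t : 0 <= lo t. Proof. by rewrite le_min !threshold_ge0. Qed.

Let lo_hi t : lo t <= hi t.
Proof. by rewrite /lo /hi ge_min !le_max lexx. Qed.

Let radix_lo_ge0 t : 0 <= (radix t)%:R * lo t. Proof. exact: mulr_ge0. Qed.

Let loss01 t : 0 <= loss t <= 1.
Proof.
have k0 : 0 <= (kap t)%:R / (radix t)%:R :> R by rewrite divr_ge0.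
have : (kap t)%:R / (radix t)%:R <= 1 :> R.
  rewrite ler_pdivrMr// mul1r ler_nat /kap; case: ifP => // /andP[_ lo1].
  by rewrite truncn_lt_nat// gtr_pMr.
rewrite /loss; lra.
Qed.

(** Rounding [lo t] up to a whole digit costs at most one unit of that digit. *)
Let lo_loss t : rel t -> 1 - lo t <= loss t + (radix t)%:R^-1.
Proof.
move=> relt; rewrite /loss /kap relt.
have : (Num.trunc ((radix t)%:R * lo t))%:R / (radix t)%:R <= lo t.
  by rewrite ler_pdivrMr// [leRHS]mulrC; have /andP[] := truncn_itv (radix_lo_ge0 t).
rewrite -[in X in _ -> X]natr1 mulrDl mul1r; lra.
Qed.

(** The net is listed in order of arrival, so the first net point to capture is also the one of
    least index. *)
Lemma cluster_min w k t : (k < n)%N -> t \in net d r n -> captures d r w k t ->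
  (cluster d r w k <= t)%N.
Proof.
move=> kn; have dk : d k k <= r by rewrite d_refl ltW.
have [-> _] := cluster_net w r_gt0 dk kn; elim: {kn}n t => //= m IH t.
case: ifP => [_|_]; last exact: IH.
rewrite mem_rcons inE filter_rcons => /predU1P[->|tm] ct; last first.
  move: (IH _ tm ct); case: ifP => // _.
  have : has (captures d r w k) (net d r m) by apply/hasP; exists t.
  by rewrite has_filter; case: seq.filter.
rewrite ct; case E : [seq t <- net d r m | captures d r w k t] => [|h s] //=.
have : h \in [seq t <- net d r m | captures d r w k t] by rewrite E inE eqxx.
by rewrite mem_filter mem_net => /andP[_ /andP[/ltnW]].
Qed.

(* [t] captures exactly one of [i], [j], and no earlier net point captures any. *)
Let missed t : set R := [set w | rel t /\
  (lo t <= coin t w < hi t /\ forall s, (s < t)%N -> rel s -> coin s w < lo s)].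

(** The pair [k], [l] is [i], [j] in the order that gives [k] the smaller label [t]. By
    [cluster_min], [t] does not capture [l], and no earlier net point captures either. *)
Let cut_missed_lt w k l : ((k == i) && (l == j)) || ((k == j) && (l == i)) ->
  (cluster d r w k < cluster d r w l)%N -> missed (cluster d r w k) w.
Proof.
move=> kl; have [kn ln] : (k < n)%N /\ (l < n)%N.
  by case/orP: kl => /andP[/eqP -> /eqP ->].
have loE s : lo s = Num.min (threshold d r s k) (threshold d r s l).
  by case/orP: kl => /andP[/eqP -> /eqP ->]//; rewrite minC.
have hiE s : hi s = Num.max (threshold d r s k) (threshold d r s l).
  by case/orP: kl => /andP[/eqP -> /eqP ->]//; rewrite maxC.
have dk : d k k <= r by rewrite d_refl ltW.
set t := cluster d r w k => tl.
have tn : t \in net d r n.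
  rewrite /t; have [-> Hh] := cluster_net w r_gt0 dk kn.
  have : head 0%N [seq t <- net d r n | captures d r w k t] \in
      [seq t <- net d r n | captures d r w k t].
    by move: Hh; rewrite has_filter; case: seq.filter => //= h s; rewrite inE eqxx.
  by rewrite mem_filter => /andP[].
have ck : captures d r w k t := captures_cluster w r_gt0 dk.
have cl : ~~ captures d r w l t.
  by apply/negP => /(cluster_min ln tn); rewrite leqNgt tl.
have lot : lo t <= coin t w by rewrite loE ge_min; move: ck; rewrite /captures => ->.
split; first by rewrite /rel tn (le_lt_trans lot)//; have /andP[] := coin_itv t w.
split; first by rewrite lot hiE lt_max; move: cl; rewrite /captures -ltNge => ->; rewrite orbT.
move=> s st /andP[sn _]; rewrite loE lt_min !ltNge; apply/andP; split; apply/negP => cs.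
  by have := cluster_min kn sn cs; rewrite leqNgt st.
by have := cluster_min ln sn cs; rewrite leqNgt (ltn_trans st).
Qed.

Let cut_missed w : cluster d r w i <> cluster d r w j ->
  exists2 t, (t < n)%N & missed t w.
Proof.
move=> /eqP; rewrite neq_ltn => /orP[] Hlt.
  have H := @cut_missed_lt w i j; rewrite !eqxx /= in H.
  exists (cluster d r w i); last exact: H.
  by have [/andP[]] := H isT Hlt; rewrite mem_net => /andP[].
have H := @cut_missed_lt w j i; rewrite !eqxx /= orbT in H.
exists (cluster d r w j); last exact: H.
by have [/andP[]] := H isT Hlt; rewrite mem_net => /andP[].
Qed.

Let coin_lt_measurable s (x : R) : measurable [set w | coin s w < x].
Proof.
have -> : [set w | coin s w < x] = setT `&` coin s @^-1` `]-oo, x[%classic.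
  by rewrite setTI; apply/seteqP; split => w /=; rewrite in_itv.
by apply: coin_measurable => //; exact: measurable_itv.
Qed.

Let coin_ge_measurable s (x : R) : measurable [set w | x <= coin s w].
Proof.
have -> : [set w | x <= coin s w] = ~` [set w | coin s w < x].
  by apply/seteqP; split => w /=; [rewrite leNgt => /negP|move=> /negP; rewrite -leNgt].
exact: measurableC.
Qed.

Let missed_measurable t : measurable (missed t).
Proof.
have -> : missed t = [set w | rel t] `&` ([set w | lo t <= coin t w] `&`
    [set w | coin t w < hi t]) `&`
    \bigcap_s (if (s < t)%N && rel s then [set w | coin s w < lo s] else setT).
  apply/seteqP; split => w /=.
    move=> [rt [/andP[a b] H]]; do !split => //= s _.
    by case: ifP => // /andP[st rs]; exact: H.
  move=> [[rt [a b]] H]; do !split => //; first by rewrite a b.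
  by move=> s st rs; have := H s I; rewrite st rs.
apply: measurableI; last by apply: bigcapT_measurable => s; case: ifP.
apply: measurableI; last exact: measurableI.
have -> : [set _ | rel t] = if rel t then setT else set0 :> set R.
  by case: (rel t); apply/seteqP; split.
by case: (rel t).
Qed.

(** The failure of each earlier net point is weakened to a bound on the leading digit of its coin,
    and [unit_law_digits] applies. *)
Let missed_prob t : (unit_law R (missed t) <=
  (if rel t then (\prod_(s < t) (1 - loss s)) * (hi t - lo t) else 0)%:E)%E.
Proof.
case: ifPn => [relt|relt]; last first.
  have -> : missed t = set0 by rewrite -subset0 => w [rt]; rewrite rt in relt.
  by rewrite measure0.
have -> : \prod_(s < t) (1 - loss s) = \prod_(s < t) ((kap s)%:R / (radix s)%:R).
  by apply: eq_bigr => s _; rewrite /loss subKr.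
apply: unit_law_digits => // w [_ [lohi H]]; split => // s st.
rewrite /kap; case: ifPn => [rels|_].
  apply: (lt_trans (y := (radix s)%:R * lo s)); first by rewrite ltr_pM2l// H.
  exact: truncnS_gt.
by rewrite gtr_pMr//; have /andP[] := coin_itv s w.
Qed.

Hypothesis d_le : d i j <= r.
Hypothesis rate_le : forall t, t \in net d r n -> rate d r t <= La.

Let d_ge0 a b : 0 <= d a b.
Proof. have := d_triangle a b a; rewrite d_refl (d_sym b); lra. Qed.

(** A radius is at most [2 * r], and the other point of the pair is within [r]. *)
Let rel_near t : rel t -> d t i <= 3 * r.
Proof.
move=> /andP[_]; rewrite /lo gt_min => /orP[] /(threshold_lt1 r_gt0).
  by have := r_gt0; lra.
by have := d_triangle t j i; rewrite (d_sym j i); move: d_le r_gt0; lra.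
Qed.

Let crowd_ge t : rel t -> (count rel (iota 0 t) <= crowd d r t)%N.
Proof.
move=> relt; rewrite /crowd -!size_filter; apply: uniq_leq_size.
  by rewrite filter_uniq// iota_uniq.
move=> s; rewrite !mem_filter mem_iota add0n /= => /andP[rels st].
have /andP[sn _] := rels.
have -> : s \in net d r t by move: sn; rewrite !mem_net st => /andP[_ ->].
have := d_triangle s i t; rewrite (d_sym i t).
by rewrite andbT; move: (rel_near rels) (rel_near relt); lra.
Qed.

(** [threshold_gap] is applied at the nearer of the two points. The digit rounding and the
    truncation term are each at most [1 / ((crowd + 1) (crowd + 2))], whence the factor 2. *)
Let gap_le t : rel t -> hi t - lo t <=
  La * (d i j / r) * (loss t + 2 * ((crowd d r t).+1%:R * (crowd d r t).+2%:R)^-1).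
Proof.
move=> relt; have /andP[tn lo1] := relt.
have lt := lo_loss relt.
have M_le : (radix t)%:R^-1 <= ((crowd d r t).+1%:R * (crowd d r t).+2%:R)^-1 :> R.
  rewrite lef_pV2 ?posrE ?mulr_gt0 ?ltr0n// ?expn_gt0//.
  rewrite -natrM ler_nat /radix -mulnn leq_mul//; have := crowd_le d r t; lia.
have E_le : expR (- rate d r t) / (1 - expR (- rate d r t)) <=
    ((crowd d r t).+1%:R * (crowd d r t).+2%:R)^-1.
  rewrite expR_rate; set c := crowd _ _ _.
  have c0 : 0 <= c%:R :> R by [].
  rewrite -[c.+2]addn2 -[c.+1]addn1 natrX !natrD.
  (* With [E = (c + 2)^-2], the truncation term [E / (1 - E)] is [1 / ((c + 2)^2 - 1)]. *)
  have -> : (c%:R + 2) ^- 2 / (1 - (c%:R + 2) ^- 2) = ((c%:R + 1) * (c%:R + 3))^-1 :> R.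
    by field; rewrite !gt_eqF//; try nra.
  by rewrite lef_pV2 ?posrE ?mulr_gt0 ?ltr_wpDl// ler_pM2l ?ltr_wpDl// lerD2l ler_nat.
set x := (_ * _)^-1 in M_le E_le *.
have La_ge0 : 0 <= La by rewrite (le_trans _ (rate_le tn))// ltW// rate_gt0.
have dr_ge0 : 0 <= d i j / r by rewrite divr_ge0// ltW.
set e := expR _ / _ in E_le.
have e_ge0 : 0 <= e by rewrite divr_ge0 ?expR_ge0// ltW// expR_rate_lt1.
have step k l : d t k <= d t l -> d t l - d t k <= d i j -> threshold d r t k <= 1 ->
    threshold d r t l - threshold d r t k <=
      La * (d i j / r) * (1 - threshold d r t k + e).
  move=> dkl dlk k1; apply: (le_trans (threshold_gap r_gt0 dkl)).
  apply: ler_wpM2r; first by rewrite addr_ge0// subr_ge0.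
  apply: ler_pM; rewrite ?rate_le//; first exact/ltW/rate_gt0.
    by rewrite divr_ge0 ?subr_ge0// ltW.
  by rewrite ler_pM2r// invr_gt0.
have main : hi t - lo t <= La * (d i j / r) * (1 - lo t + e).
  move: lo1; rewrite /lo /hi; case: (leP (d t i) (d t j)) => dt.
    have ij := threshold_le r_gt0 dt.
    rewrite (min_l ij) (max_r ij) => /ltW; apply: step => //.
    by have := d_triangle t i j; lra.
  have ij := threshold_le r_gt0 (ltW dt).
  rewrite (min_r ij) (max_l ij) => /ltW; apply: step => //; first exact: ltW.
  by have := d_triangle t j i; rewrite (d_sym j i); lra.
apply: (le_trans main); apply: ler_wpM2l; first exact: mulr_ge0.
by move: lt M_le E_le; lra.
Qed.

(** Union bound over the net point that decides the cut. By [gap_le], the [loss] parts are first-hit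
    probabilities of total at most 1, and the error parts sum to at most 2 by [sum_rank]; hence the
    constant 3. *)
Lemma cluster_cut_prob (A : set R) : measurable A ->
  (forall w, A w -> cluster d r w i <> cluster d r w j) ->
  (unit_law R A <= (3 * La * (d i j / r))%:E)%E.
Proof.
move=> mA HA.
have mU : measurable (\big[setU/set0]_(t < n) missed t).
  by apply: bigsetU_measurable => t _; exact: missed_measurable.
apply: (@le_trans _ _ (\sum_(t < n) unit_law R (missed t))%E).
  apply: content_subadditive => //.
    by move=> t _; exact: missed_measurable.
  move=> w /HA /cut_missed[t tn Ht].
  by rewrite -bigcup_mkord; exists t.
apply: (@le_trans _ _ (\sum_(t < n)
    (if rel t then (\prod_(s < t) (1 - loss s)) * (hi t - lo t) else 0)%:E)%E).
  by apply: lee_sum => t _; exact: missed_prob.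
rewrite sumEFin lee_fin -big_mkcond /=.
have La_ge0 : 0 <= La.
  have n0 : 0%N \in net d r n by rewrite mem_net (leq_ltn_trans _ i_lt).
  by rewrite (le_trans _ (rate_le n0))// ltW// rate_gt0.
have dr_ge0 : 0 <= La * (d i j / r) by rewrite mulr_ge0// divr_ge0// ltW.
have prod01 t : 0 <= \prod_(s < t) (1 - loss s) <= 1.
  apply/andP; split; first by apply: prodr_ge0 => s _; have := loss01 s; lra.
  by apply: prodr_ile1 => s _; have := loss01 s; lra.
pose X t : R := ((crowd d r t).+1%:R * (crowd d r t).+2%:R)^-1.
have X_ge0 t : 0 <= X t by rewrite invr_ge0 mulr_ge0.
apply: (@le_trans _ _ (La * (d i j / r) *
    (\sum_(t < n | rel t) (\prod_(s < t) (1 - loss s)) * loss t +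
     2 * \sum_(t < n | rel t) X t))).
  rewrite mulr_sumr -big_split mulr_sumr /=; apply: ler_sum => t relt.
  have /andP[p0 p1] := prod01 t.
  apply: (le_trans (ler_wpM2l p0 (gap_le relt))).
  rewrite mulrCA; apply: ler_wpM2l => //; rewrite mulrDr lerD2l.
  by rewrite ler_piMl// mulr_ge0.
have S1 : \sum_(t < n | rel t) (\prod_(s < t) (1 - loss s)) * loss t <= 1.
  apply: le_trans (sum_first_hit n loss01); rewrite big_mkcond /=; apply: ler_sum => t _.
  case: ifP => // _; apply: mulr_ge0; first by case/andP: (prod01 t).
  by case/andP: (loss01 t).
have S2 : \sum_(t < n | rel t) X t <= 1.
  by apply: sum_rank => t _; exact: crowd_ge.
have -> : 3 * La * (d i j / r) = La * (d i j / r) * (1 + 2 * 1) by ring.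
by apply: ler_wpM2l => //; apply: lerD => //; apply: ler_wpM2l.
Qed.

End CutProbability.

(** * Measurability of the clustering events *)

Section ClusterMeasurable.
Variables (R : realType) (d : nat -> nat -> R) (r : R).

Lemma cluster_measurable j m : measurable [set w | cluster d r w j = m].
Proof.
rewrite /cluster; elim: (net d r j.+1) => [|t s IH] /=.
  by have [->|m0] := eqVneq m 0%N; [rewrite (_ : [set _ | _] = setT)//|
    rewrite (_ : [set _ | _] = set0)//]; apply/seteqP; split => // w /= m0';
    rewrite m0' eqxx in m0.
have mc : measurable [set w | captures d r w j t].
  have -> : [set w | captures d r w j t] =
      setT `&` coin t @^-1` `[threshold d r t j, +oo[%classic.
    by rewrite setTI; apply/seteqP; split => w /=; rewrite in_itv /= andbT.
  by apply: coin_measurable => //; exact: measurable_itv.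
have -> : [set w | head 0%N (if captures d r w j t then t :: [seq x <- s | captures d r w j x]
      else [seq x <- s | captures d r w j x]) = m] =
    ([set w | captures d r w j t] `&` (if t == m then setT else set0)) `|`
    (~` [set w | captures d r w j t] `&`
      [set w | head 0%N [seq x <- s | captures d r w j x] = m]).
  apply/seteqP; split => w /=; case: (captures d r w j t) => /=.
  - by move=> ->; left; rewrite eqxx.
  - by right.
  - by case=> [[_]|[]//]; case: eqP.
  - by case=> [[]//|[]].
apply: measurableU; first by apply: measurableI => //; case: ifP.
by apply: measurableI => //; exact: measurableC.
Qed.

Lemma cut_measurable i j : measurable [set w | cluster d r w i <> cluster d r w j].
Proof.
have -> : [set w | cluster d r w i <> cluster d r w j] =
    ~` \bigcup_m ([set w | cluster d r w i = m] `&` [set w | cluster d r w j = m]).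
  apply/seteqP; split => w /= H.
    by move=> [m _ [/= im jm]]; apply: H; rewrite im jm.
  by move=> ij; apply: H; exists (cluster d r w j).
apply: measurableC; apply: bigcupT_measurable => m.
by apply: measurableI; exact: cluster_measurable.
Qed.

End ClusterMeasurable.

(** * Consequences of the doubling property *)

Section Doubling.
Variables (R : realType) (X : metricType R).

Lemma doubling_cover (S : set X) ddim : has_doubling_dimension S ddim ->
  forall (m : nat) (c : X) (r : R), S c -> 0 < r ->
  exists s : seq X, [/\ (size s)%:R <= (2 `^ ddim) ^+ m,
    forall p, p \in s -> S p &
    forall q, S q -> mdist c q <= 2 ^+ m * r -> exists2 p, p \in s & mdist p q <= r].
Proof.
move=> HS; elim=> [|m IH] c r Sc r0.
  exists [:: c]; split => //= [p|q Sq]; first by rewrite inE => /eqP ->.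
  by rewrite expr0 mul1r => cq; exists c; rewrite ?inE.
have [s0 [s0K s0S s0c]] := HS c (2 ^+ m * r) Sc (mulr_gt0 (exprn_gt0 m (ltr0Sn R 1)) r0).
(* The induction hypothesis is applied at every center of [s0] and the resulting lists are
   concatenated. *)
have [s [sK sS sc]] : exists s : seq X,
    [/\ (size s)%:R <= (size s0)%:R * (2 `^ ddim) ^+ m,
    forall p, p \in s -> S p &
    forall p q, p \in s0 -> S q -> mdist p q <= 2 ^+ m * r ->
      exists2 p', p' \in s & mdist p' q <= r].
  elim: s0 s0S {s0K s0c} => [|p s0 IHs] s0S; first by exists [::]; rewrite mul0r.
  have [|s [sK sS sc]] := IHs; first by move=> q qs; apply: s0S; rewrite inE qs orbT.
  have [s' [s'K s'S s'c]] := IH p r (s0S p (mem_head _ _)) r0.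
  exists (s' ++ s); split.
  - by rewrite size_cat natrD [size (p :: s0)]/= -natr1 mulrDl mul1r addrC lerD.
  - by move=> q; rewrite mem_cat => /orP[/s'S|/sS].
  - move=> q q'; rewrite inE => /predU1P[->|qs] Sq' d.
      by have [p' ? ?] := s'c q' Sq' d; exists p'; rewrite // mem_cat; apply/orP; left.
    by have [p' ? ?] := sc q q' qs Sq' d; exists p'; rewrite // mem_cat; apply/orP; right.
exists s; split => //.
  by rewrite (le_trans sK)// exprS ler_wpM2r// exprn_ge0// powR_ge0.
move=> q Sq; rewrite exprS -mulrA => /(s0c q Sq)[p ps0 pq].
exact: sc ps0 Sq pq.
Qed.

(** A ball of radius [r / 2] contains at most one point of an [r]-separated family, so a cover by
    such balls bounds its size. *)
Lemma doubling_packing (S : set X) ddim (x : nat -> X) m c r (L : seq nat) :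
  has_doubling_dimension S ddim -> S c -> 0 < r -> uniq L ->
  {in L &, forall a b, a != b -> r < mdist (x a) (x b)} ->
  {in L, forall a, S (x a) /\ mdist c (x a) <= 2 ^+ m * (r / 2)} ->
  (size L)%:R <= (2 `^ ddim) ^+ m.
Proof.
move=> HS Sc r0 uL sepL nearL.
have [s [sK _ sc]] := doubling_cover HS m Sc (divr_gt0 r0 (ltr0Sn R 1)).
have /choice[f Hf] : forall a, exists p, a \in L -> p \in s /\ mdist p (x a) <= r / 2.
  move=> a; have [aL|_] := boolP (a \in L); last by exists c.
  by have [Sa /(sc _ Sa)[p ps pa]] := nearL a aL; exists p.
apply: le_trans sK; rewrite ler_nat -(size_map f); apply: uniq_leq_size.
  rewrite map_inj_in_uniq// => a b aL bL fab; apply/eqP/negPn/negP => ab.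
  have := sepL a b aL bL ab; have [_ fa] := Hf a aL; have [_ fb] := Hf b bL.
  have := metric_triangle (x a) (f a) (x b); rewrite (metric_sym (x a) (f a)) {2}fab; lra.
by move=> _ /mapP[a aL ->]; have [] := Hf a aL.
Qed.

Lemma fin_min (I : finType) (P : pred I) (F : I -> R) i0 : P i0 ->
  exists2 i, P i & forall j, P j -> F i <= F j.
Proof. by move=> Pi0; case: (arg_minP F Pi0) => i Pi H; exists i. Qed.

Variables (x : nat -> X) (k : nat).
Local Notation S := (prefix_set x k).

Lemma prefix_setP p : S p -> exists i : 'I_k, p = x i.
Proof. by move=> [i /= ik <-]; exists (Ordinal ik). Qed.

Lemma prefix_set_ord (i : 'I_k) : S (x i).
Proof. by exists i => /=. Qed.

Lemma closest_pair (i j : 'I_k) : x i <> x j -> exists a b : 'I_k,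
  x a <> x b /\ forall p q, S p -> S q -> p <> q -> mdist (x a) (x b) <= mdist p q.
Proof.
move=> /eqP ij.
have [[a b] /= ab H] := @fin_min ('I_k * 'I_k)%type (fun u => x u.1 != x u.2)
  (fun u => mdist (x u.1) (x u.2)) (i, j) ij.
exists a, b; split; first exact/eqP.
move=> _ _ /prefix_setP[a' ->] /prefix_setP[b' ->] /eqP ab'.
exact: (H (a', b')).
Qed.

(** Around one point of a closest pair, balls of half the minimum distance are singletons, so at
    least two of them are needed to cover both points. *)
Lemma ddim_ge1 (i j : 'I_k) ddim : x i <> x j -> has_doubling_dimension S ddim ->
  1 <= ddim.
Proof.
move=> /closest_pair[a [b [/eqP ab minab]]] HS.
have d0 : 0 < mdist (x a) (x b) by rewrite mdist_gt0.
have [s [sK sS sc]] := HS (x a) (mdist (x a) (x b) / 2) (prefix_set_ord a)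
  (divr_gt0 d0 (ltr0Sn R 1)).
have near c : S c -> mdist (x a) c <= mdist (x a) (x b) -> c \in s.
  move=> Sc ac; have [|p ps pc] := sc c Sc; first by rewrite mulrC divfK.
  have [<-//|/eqP pc'] := eqVneq p c.
  by have := minab p c (sS p ps) Sc pc'; lra.
have : (2 <= size s)%N.
  have u2 : uniq [:: x a; x b] by rewrite /= inE ab.
  rewrite (uniq_leq_size u2)// => c; rewrite !inE => /orP[] /eqP ->; apply: near.
  - exact: prefix_set_ord.
  - by rewrite mdistxx ltW.
  - exact: prefix_set_ord.
  - exact: lexx.
rewrite -(ler_nat R) => /le_trans /(_ sK).
rewrite -ler_ln ?posrE ?powR_gt0// ln_powR -[leLHS]mul1r ler_pM2r//.
by rewrite ln_gt0// ltr1n.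
Qed.

Lemma aspect_ratio_ge (a b i j : 'I_k) : x i <> x j ->
  mdist (x a) (x b) <= aspect_ratio S * mdist (x i) (x j).
Proof.
move=> ij; have [a' [b' [/eqP ab' minab]]] := closest_pair ij.
have d0 : 0 < mdist (x a') (x b') by rewrite mdist_gt0.
have dij0 : 0 < mdist (x i) (x j) by rewrite mdist_gt0; exact/eqP.
rewrite /aspect_ratio; set A := [set _ | _]; set B := [set _ | _].
have supA : mdist (x a) (x b) <= sup A.
  apply: ub_le_sup; last by exists (x a), (x b); split => //; exact: prefix_set_ord.
  have [[u v] _ H] := @fin_min ('I_k * 'I_k)%type predT
    (fun u => - mdist (x u.1) (x u.2)) (a, b) isT.
  exists (mdist (x u) (x v)) => _ [p [q [/prefix_setP[u' ->] /prefix_setP[v' ->] ->]]].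
  by have := H (u', v') isT; rewrite lerN2.
have Bij : B (mdist (x i) (x j)).
  by exists (x i), (x j); split => //; exact: prefix_set_ord.
have lbB : lbound B (mdist (x a') (x b')).
  by move=> _ [p [q [Sp Sq pq ->]]]; exact: minab.
have infB0 : 0 < inf B.
  by rewrite (lt_le_trans d0)//; apply: lb_le_inf => //; exists (mdist (x i) (x j)).
have infB : inf B <= mdist (x i) (x j) by apply: ge_inf => //; exists (mdist (x a') (x b')).
apply: (le_trans supA); rewrite mulrAC -mulrA ler_peMr//.
  by apply: le_trans supA; exact: mdist_ge0.
by rewrite ler_pdivlMr// mul1r.
Qed.

(** The point [t] and its crowd are [r]-separated and within [6 * r <= 2^4 * (r / 2)] of [t], so
    [crowd + 1] is at most [K^4] for [K = 2 ^ ddim]. As [K >= 2], this gives [crowd + 2 <= K^5], and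
    the rate is twice a logarithm. *)
Lemma rate_le_ddim (i j : 'I_k) ddim r n t : x i <> x j ->
  has_doubling_dimension S ddim -> 0 < r -> (n <= k)%N ->
  t \in net (fun a b => mdist (x a) (x b)) r n ->
  rate (fun a b => mdist (x a) (x b)) r t <= 10 * ddim * ln 2.
Proof.
move=> ij HS r0 nk; set d := fun a b => _ => tn.
have K2 : 2 <= 2 `^ ddim :> R.
  by rewrite -[leLHS]powRr1// ler_powR ?ler1n//; exact: ddim_ge1 ij HS.
have [tln tsep] := andP (etrans (esym (mem_net d r n t)) tn).
have tk : (t < k)%N by apply: leq_trans nk.
pose L := t :: [seq c <- net d r t | d c t <= 6 * r].
have sep a b : a \in net d r n -> b \in net d r n -> a != b -> r < d a b.
  wlog ab : a b / (a < b)%N.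
    move=> H an bn; rewrite neq_ltn => /orP[] ab; first by apply: H => //; rewrite ltn_eqF.
    by rewrite /d metric_sym; apply: H => //; rewrite ltn_eqF.
  rewrite !mem_net => /andP[_ asep] /andP[bn /allP bsep] _; apply: bsep.
  by rewrite mem_net ab.
have Ln a : a \in L -> a \in net d r n.
  rewrite inE => /predU1P[->//|]; rewrite mem_filter => /andP[_].
  by rewrite !mem_net => /andP[at_ ->]; rewrite (ltn_trans at_).
have HL : (size L)%:R <= (2 `^ ddim) ^+ 4 :> R.
  apply: (@doubling_packing S ddim x 4 (x t) r) => //.
  - by exists t.
  - by rewrite /L /= mem_filter mem_net ltnn !andbF filter_uniq// net_uniq.
  - by move=> a b /Ln an /Ln bn; exact: sep.
  - move=> a aL; split.
      exists a => //=; have := Ln a aL; rewrite mem_net => /andP[an _].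
      exact: leq_trans nk.
    move: aL; rewrite inE => /predU1P[->|].
      by rewrite mdistxx mulr_ge0// ?exprn_ge0// divr_ge0// ltW.
    rewrite mem_filter => /andP[+ _]; rewrite /d metric_sym.
    rewrite -natrX; have -> : (2 ^ 4)%N = 16%N by [].
    by have := r0; lra.
rewrite /rate; have -> : 10 * ddim * ln 2 = 2 * (ln (2 `^ ddim) *+ 5) :> R.
  by rewrite ln_powR -mulr_natl; ring.
have K0 : 0 < 2 `^ ddim :> R by rewrite powR_gt0.
rewrite ler_pM2l// -lnXn// ler_ln ?posrE ?ltr0n ?exprn_gt0// exprSr.
have sL : size L = (crowd d r t).+1 by rewrite /= size_filter.
rewrite sL in HL.
apply: (@le_trans _ _ ((crowd d r t).+1%:R * 2)); last by apply: ler_pM.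
by rewrite -natrM ler_nat; lia.
Qed.

End Doubling.

(** * The embedding *)

Section Embedding.
Variable R : realType.

Lemma exp2zS (s : int) : 2 ^ (s + 1) = 2 * 2 ^ s :> R.
Proof. by rewrite expfzDr ?pnatr_eq0// expr1z mulrC. Qed.

Lemma exp2z_sub3 (s : int) : 2 ^ s = 8 * 2 ^ (s - 3) :> R.
Proof.
have {1}-> : s = s - 3 + 1 + 1 + 1 by ring.
by rewrite !exp2zS; ring.
Qed.

Lemma le_exp2_nat (y : R) : exists m : nat, y <= 2 ^ m%:Z.
Proof.
exists (Num.trunc y).+1; rewrite (le_trans (ltW (truncnS_gt y)))//.
by rewrite -exprnP -natrX ler_nat ltnW// ltn_expl.
Qed.

Lemma dyadic_scale (y : R) : 0 < y -> exists s : int, y <= 2 ^ s < 2 * y.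
Proof.
move=> y0; have [m0 Hm0] := le_exp2_nat (2 / y).
have [m1 Hm1] := le_exp2_nat y.
have low : 2 ^ (- m0%:Z) < y.
  rewrite -invr_expz invf_plt ?posrE ?exp2z_gt0// (lt_le_trans _ Hm0)//.
  by rewrite -[ltLHS]mul1r ltr_pM2r ?invr_gt0// ltr1n.
have exm : exists m : nat, y <= 2 ^ (m%:Z - m0%:Z).
  by exists (m1 + m0)%N; rewrite PoszD addrK.
case: (ex_minnP exm) => m Hm minm; exists (m%:Z - m0%:Z); rewrite Hm /=.
case: m Hm minm => [|m] Hm minm.
  by move: Hm; rewrite sub0r leNgt low.
have : ~~ (y <= 2 ^ (m%:Z - m0%:Z)) by apply/negP => /minm; rewrite ltnn.
rewrite -ltNge => Hlt.
have -> : m.+1%:Z - m0%:Z = m%:Z - m0%:Z + 1 by rewrite -addn1 PoszD; ring.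
by rewrite exp2zS ltr_pM2l.
Qed.

Lemma cluster_top (d : nat -> nat -> R) w j :
  `[< exists N : int, forall i, N <= i -> cluster d (2 ^ i) w j = 0%N >].
Proof.
apply/asboolP; have [m Hm] := le_exp2_nat (d 0%N j).
exists m%:Z => i mi; apply: cluster_far; first exact: exp2z_gt0.
by rewrite (le_trans Hm)// ler_exp2z.
Qed.

Definition embed (d : nat -> nat -> R) w j : labeling_metric R :=
  exist _ (fun i : int => cluster d (2 ^ i) w j) (cluster_top d w j).

(** The value [0] outside the matrix is never consulted: the label of [j] only involves indices up
    to [j]. *)
Definition dist_of k (M : 'M[R]_k) a b : R :=
  match insub a, insub b with Some i, Some j => M i j | _, _ => 0 end.

Definition hst_algorithm : online_algorithm R (labeling_metric R) :=
  fun k M w i => embed (dist_of M) w i.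

(** The finitely many distances are [0] or [8 * 2 ^ s] with [s] between [-B] and [B]. Level [0]
    stands for the distance [0], and the level of scale [s] is [s + B + 1]. *)
Lemma labeling_HST n (f : 'I_n.+1 -> labeling_metric R) : is_HST 2 (range f).
Proof.
have /choice[s Hs] : forall u : 'I_n.+1 * 'I_n.+1, exists s : int,
    mdist (f u.1) (f u.2) = 0 \/ mdist (f u.1) (f u.2) = 8 * 2 ^ s.
  move=> u; have [->|/eqP uv] := eqVneq (f u.1) (f u.2).
    by exists 0; left; rewrite mdistxx.
  have [s [ds sup_s]] := labeling_neq_top uv.
  by exists s; right; rewrite mdist_labeling (ldistE R ds sup_s).
pose B := \max_(u : 'I_n.+1 * 'I_n.+1) `|s u|%N.
have sB u : (`|s u| <= B)%N by exact: leq_bigmax.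
pose G l : R := if l is l'.+1 then 8 * 2 ^ (l'%:Z - B%:Z) else 0.
apply: (@is_HST_levels R _ 2 n (B + B).+1 f G) => //.
- exact: labeling_ultrametric.
- by rewrite ler1n.
- by case=> [|l] //=; rewrite mulr_ge0// ltW// exp2z_gt0.
- case=> [|l] /=; first by rewrite mulr0 mulr_ge0// ltW// exp2z_gt0.
  have -> : l.+1%:Z - B%:Z = l%:Z - B%:Z + 1 by rewrite -addn1 PoszD; ring.
  by rewrite exp2zS mulrCA.
- move=> i j; have [->|->] := Hs (i, j); first by exists 0%N.
  have sij := sB (i, j).
  exists (absz (s (i, j) + B%:Z)%R).+1; first lia.
  rewrite /G; congr (8 * 2 ^ _); lia.
Qed.

Lemma bigmax_measurable (disp : measure_display) (T : measurableType disp) n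
    (f : nat -> T -> R) :
  (forall m, measurable_fun setT (f m)) ->
  measurable_fun setT (fun w => \big[Num.max/0]_(m < n) f m w).
Proof.
elim: n f => [|n IH] f mf.
  rewrite (_ : (fun _ => _) = cst 0); first exact: measurable_cst.
  by apply/funext => w; rewrite big_ord0.
rewrite (_ : (fun _ => _) = f 0%N \max (fun w => \big[Num.max/0]_(m < n) f m.+1 w)).
  by apply: measurable_maxr => //; exact: (IH (fun m => f m.+1)).
by apply/funext => w; rewrite big_ord_recl.
Qed.

Lemma expectation_le_indic (disp : measure_display) (T : measurableType disp)
    (P : probability T R) n (D : T -> R) (c : R) (a p : nat -> R) (A : nat -> set T) :
  measurable_fun setT D -> (forall w, 0 <= D w) -> 0 <= c ->
  (forall m, 0 <= a m) -> (forall m, measurable (A m)) ->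
  (forall m, (m < n)%N -> (P (A m) <= (p m)%:E)%E) ->
  (forall w, D w <= c + \sum_(m < n) a m * \1_(A m) w) ->
  ('E_P[D] <= (c + \sum_(m < n) a m * p m)%:E)%E.
Proof.
move=> mD D0 c0 a0 mA PA Dle; rewrite unlock.
apply: (@le_trans _ _ (\int[P]_w (c%:E + \sum_(m < n) (a m)%:E * (\1_(A m) w)%:E))%E).
  apply: ge0_le_integral => //.
  - by move=> w _; rewrite lee_fin.
  - exact/measurable_EFinP.
  - apply/emeasurable_funD; first exact: measurable_cst.
    apply: emeasurable_sum => m; apply: emeasurable_funM; first exact: measurable_cst.
    by apply/measurable_EFinP; exact: measurable_indic.
  - move=> w _; under eq_bigr do rewrite -EFinM.
    by rewrite sumEFin -EFinD lee_fin.
have term_ge0 m w : (0 <= (a m)%:E * (\1_(A m) w)%:E)%E by rewrite -EFinM lee_fin mulr_ge0.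
have term_meas m : measurable_fun setT (fun w => (a m)%:E * (\1_(A m) w)%:E)%E.
  apply: emeasurable_funM; first exact: measurable_cst.
  by apply/measurable_EFinP; exact: measurable_indic.
rewrite ge0_integralD//; last 2 first.
- by move=> w _; apply: sume_ge0.
- exact: emeasurable_sum.
rewrite integral_cst//= [X in (_ * X)%E]probability_setT mule1 EFinD leeD2l//.
rewrite ge0_integral_sum// -sumEFin; apply: lee_sum => m _.
rewrite ge0_integralZl_EFin//; last first.
  by apply/measurable_EFinP; exact: measurable_indic.
by rewrite integral_indic// setIT EFinM lee_wpmul2l ?lee_fin// PA.
Qed.

Variables (X : metricType R) (x : nat -> X).
Let d a b := mdist (x a) (x b).

Let d_sym a b : d a b = d b a. Proof. exact: metric_sym. Qed.
Let d_triangle a b c : d a c <= d a b + d b c. Proof. exact: metric_triangle. Qed.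
Let d_refl a : d a a = 0. Proof. exact: mdistxx. Qed.

(** The right-hand side does not depend on [k]: images never change as further points arrive. *)
Lemma run_embed w k (i : 'I_k) : run hst_algorithm x w k i = embed d w i.
Proof.
apply/val_inj/funext => s; apply: cluster_ext => a b ai bi.
rewrite /dist_of; case: insubP => [a' _ a'E|]; last by rewrite (leq_ltn_trans ai).
case: insubP => [b' _ b'E|]; last by rewrite (leq_ltn_trans bi).
by rewrite mxE a'E b'E.
Qed.

Lemma embed_eq w i j : x i = x j -> embed d w i = embed d w j.
Proof.
move=> xij; apply/val_inj/funext => s /=.
have s0 := exp2z_gt0 R s.
have di a : d a a <= 2 ^ s by rewrite d_refl ltW.
(* Both labels are read off one net long enough for [i] and [j]; equal points then have equal
   thresholds. *)
have [-> _] := cluster_net w s0 (di i) (leq_maxl i.+1 j.+1).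
have [-> _] := cluster_net w s0 (di j) (leq_maxr i.+1 j.+1).
suff -> : captures d (2 ^ s) w i = captures d (2 ^ s) w j by [].
by apply/funext => t; rewrite /captures /threshold /d xij.
Qed.

Lemma embed_dominates w i j : d i j <= mdist (embed d w i) (embed d w j).
Proof.
have diam s : cluster d (2 ^ s) w i = cluster d (2 ^ s) w j -> d i j <= 4 * 2 ^ s.
  by apply: cluster_diam => //; exact: exp2z_gt0.
have [eij|/eqP nij] := eqVneq (embed d w i) (embed d w j).
  rewrite eij mdistxx leNgt; apply/negP => d0.
  (* Equal images share a cluster at scale [s - 3], whose diameter is at most
     [4 * 2 ^ (s - 3) = 2 ^ s / 2 < d i j]. *)
  have [s /andP[ds sd]] := dyadic_scale d0.
  have := diam (s - 3) (congr1 (fun y : labeling => val y (s - 3)) eij).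
  by have := exp2z_gt0 R (s - 3); move: ds sd; rewrite (exp2z_sub3 s); lra.
have [s [ds sup_s]] := labeling_neq_top nij.
rewrite mdist_labeling (ldistE R ds sup_s).
(* The points share a cluster at scale [s + 1], of diameter at most [4 * 2 ^ (s + 1)]; this explains
   the factor 8 in the distance of labelings. *)
have -> : 8 * 2 ^ s = 4 * 2 ^ (s + 1) :> R by rewrite exp2zS; ring.
by apply: diam; apply: sup_s; rewrite ltrDl.
Qed.

(** From [ln (1 + x) <= x] at [x = - 1 / 2]. *)
Lemma ln2_ge : 2^-1 <= ln 2 :> R.
Proof.
have := @le_ln1Dx R (- 2^-1).
have -> : 1 + - 2^-1 = 2^-1 :> R by field.
rewrite lnV ?posrE// => /(_ _) H.
by rewrite -lerN2; apply: H; lra.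
Qed.

Section Distance.
Variables (k : nat) (i j : 'I_k).
Hypothesis xij : x i <> x j.

Let D w : R := mdist (embed d w i) (embed d w j).
Let cut s := [set w | cluster d (2 ^ s) w i <> cluster d (2 ^ s) w j].

Let dij_gt0 : 0 < d i j. Proof. by rewrite mdist_gt0; exact/eqP. Qed.

Let cut_low w s : 4 * 2 ^ s < d i j -> cut s w.
Proof.
move=> sd; rewrite /cut /= => /cluster_diam - /(_ (exp2z_gt0 R s)).
by move=> /(_ d_sym d_triangle d_refl); rewrite leNgt sd.
Qed.

Let cut_high w s : d 0%N i <= 2 ^ s -> d 0%N j <= 2 ^ s -> ~ cut s w.
Proof. by move=> di dj; apply; rewrite !cluster_far// exp2z_gt0. Qed.

Let exp2z_shift (s : int) m : 2 ^ (s + m%:Z) = 2 ^ s * 2 ^+ m :> R.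
Proof. by rewrite expfzDr ?pnatr_eq0. Qed.

(** From scale [s + n] on, the first point captures both [i] and [j], so they are not cut.
    Minimality of [n] is what later bounds it by the logarithm of the aspect ratio. *)
Lemma top_scale (s : int) : exists n : nat,
  d 0%N i <= 2 ^ (s + n%:Z) /\ d 0%N j <= 2 ^ (s + n%:Z) /\
  forall m, (m < n)%N -> 2 ^ (s + m%:Z) < Num.max (d 0%N i) (d 0%N j).
Proof.
have exn : exists n : nat, Num.max (d 0%N i) (d 0%N j) <= 2 ^ (s + n%:Z).
  have [m Hm] := le_exp2_nat (Num.max (d 0%N i) (d 0%N j)).
  exists (m + `|s|)%N; rewrite (le_trans Hm)// ler_exp2z//; lia.
case: (ex_minnP exn) => n; rewrite ge_max => /andP[ni nj] n_min.
exists n; do 2 split => //; move=> m mn; rewrite ltNge; apply/negP => /n_min.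
by rewrite leqNgt mn.
Qed.

(** The distance is a finite maximum of scaled indicators of cuts: scales up to [s - 3] are always
    cut and are dominated by [s - 3], and high scales are never cut. *)
Lemma distance_measurable : measurable_fun setT D.
Proof.
have [s /andP[_ sd]] := dyadic_scale dij_gt0.
have s3 : 4 * 2 ^ (s - 3) < d i j.
  by move: sd; rewrite (exp2z_sub3 s); lra.
have [n [ni [nj _]]] := top_scale (s - 3).
pose f m w : R := 8 * 2 ^ (s - 3 + m%:Z) * \1_(cut (s - 3 + m%:Z)) w.
have -> : D = fun w => \big[Num.max/0]_(m < n.+1) f m w.
  apply/funext => w; apply/le_anti/andP; split.
    have f_le (m : 'I_n.+1) : f m w <= \big[Num.max/0]_(m < n.+1) f m w.
      by apply: (@le_bigmax _ _ _ _ (fun m : 'I_n.+1 => f m w)).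
    rewrite /D mdist_labeling; apply: ldist_le => [|t cut_t].
      by apply: le_trans (f_le ord0); rewrite /f !mulr_ge0// ltW// exp2z_gt0.
    have [ts|st] := leP t (s - 3).
      apply: le_trans (f_le ord0); rewrite /f addr0 indicE mem_set; last exact: cut_low.
      by rewrite mulr1 ler_pM2l// ler_exp2z.
    have [m tE] : exists m : nat, t = s - 3 + m%:Z by exists (absz (t - (s - 3))%R); lia.
    have mn : (m < n.+1)%N.
      rewrite ltnS leqNgt; apply/negP => nm; apply: (@cut_high w t) cut_t.
        by rewrite (le_trans ni)// ler_exp2z// tE lerD2l; lia.
      by rewrite (le_trans nj)// ler_exp2z// tE lerD2l; lia.
    apply: le_trans (f_le (Ordinal mn)).
    by rewrite /f /= -tE indicE mem_set// mulr1.
  apply: bigmax_le => [|m _]; first exact: mdist_ge0.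
  rewrite /f indicE; case: (boolP (_ \in _)) => [/set_mem cm|_].
    by rewrite mulr1 /D mdist_labeling; exact: ldist_ge.
  by rewrite mulr0 mdist_ge0.
apply: bigmax_measurable => m; apply: measurable_funM; first exact: measurable_cst.
by apply: measurable_indic; exact: cut_measurable.
Qed.

(** Scales up to [s] cost at most [8 * 2 ^ s <= 16 * d i j], hence at most 32 units of
    [ddim * ln Phi * d i j]. Each of the [n] higher scales costs [24 * La * d i j] in expectation,
    together at most 480 units. *)
Lemma expected_distance ddim : has_doubling_dimension (prefix_set x k) ddim ->
  ('E_(unit_law R)[D] <=
   (512 * (ddim * ln (Num.max 2 (aspect_ratio (prefix_set x k)))) * d i j)%:E)%E.
Proof.
move=> HS; set Phi := Num.max 2 _.
have ddim1 := ddim_ge1 xij HS.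
have [s /andP[ds sd]] := dyadic_scale dij_gt0.
have [n [ni [nj ntop]]] := top_scale s.
have k0 : (0 < k)%N by rewrite (leq_ltn_trans _ (ltn_ord i)).
have aspect a : (a < k)%N -> d 0%N a <= Phi * d i j.
  move=> ak; rewrite (le_trans (aspect_ratio_ge (Ordinal k0) (Ordinal ak) xij))//.
  by rewrite ler_pM2r// le_max lexx orbT.
have Phi2 : 2 <= Phi by rewrite le_max lexx.
have lnPhi : ln 2 <= ln Phi by rewrite ler_ln ?posrE// (lt_le_trans _ Phi2).
(* For [n > 0], scale [s + n - 1] is below [Phi * d i j <= Phi * 2 ^ s], so [2 ^ (n - 1) < Phi];
   with [2 <= Phi] this gives [2 ^ n <= Phi ^ 2]. *)
have n_le : n%:R * ln 2 <= 2 * ln Phi.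
  case: n ni nj ntop => [|n] _ _ ntop.
    by rewrite mul0r mulr_ge0// (le_trans _ lnPhi)// ln_ge0// ler1n.
  have : 2 ^ s * 2 ^+ n < Phi * d i j.
    rewrite -exp2z_shift (lt_le_trans (ntop n (ltnSn n)))//.
    by rewrite ge_max !aspect.
  have Phi0 : 0 < Phi by rewrite (lt_le_trans _ Phi2).
  have e0 : 0 < 2 ^+ n :> R by rewrite exprn_gt0.
  move=> Hlt; have {Hlt} Hlt : 2 ^+ n < Phi.
    by rewrite -(ltr_pM2r dij_gt0) (le_lt_trans _ Hlt)// mulrC ler_pM2r.
  rewrite mulr_natl mulr_natl -!lnXn// ler_ln ?posrE ?exprn_gt0// exprS expr2.
  by apply: ler_pM => //; exact: ltW.
pose La := 10 * ddim * ln 2 : R.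
have cutP m : (m < n)%N ->
    (unit_law R (cut (s + m%:Z)) <= (3 * La * (d i j / 2 ^ (s + m%:Z)))%:E)%E.
  move=> mn; apply: (@cluster_cut_prob R d _ i j k La) => //.
  - exact: exp2z_gt0.
  - by rewrite (le_trans ds)// ler_exp2z// lerDl.
  - by move=> t; apply: (rate_le_ddim xij HS) => //; exact: exp2z_gt0.
  - exact: cut_measurable.
have := @expectation_le_indic _ _ (unit_law R) n D (8 * 2 ^ s)
  (fun m => 8 * 2 ^ (s + m%:Z)) (fun m => 3 * La * (d i j / 2 ^ (s + m%:Z)))
  (fun m => cut (s + m%:Z)) distance_measurable.
have s_ge0 t : 0 <= 8 * 2 ^ t :> R by rewrite mulr_ge0// ltW// exp2z_gt0.
have sum_ge0 w : 0 <= \sum_(m < n) 8 * 2 ^ (s + m%:Z) * \1_(cut (s + m%:Z)) w :> R.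
  by apply: sumr_ge0 => m _; rewrite mulr_ge0.
move=> /(_ (fun w => mdist_ge0 _ _) (s_ge0 s) (fun m => s_ge0 _)).
move=> /(_ (fun m => cut_measurable _ _ _ _) cutP) H.
apply: le_trans (H _) _ => {H} [w|].
  rewrite /D mdist_labeling; apply: ldist_le => [|t cut_t].
    by rewrite addr_ge0.
  have [ts|st] := leP t s.
    by rewrite (@le_trans _ _ (8 * 2 ^ s)) ?ler_pM2l ?ler_exp2z// lerDl.
  have [m tE] : exists m : nat, t = s + m%:Z by exists (absz (t - s)%R); lia.
  have mn : (m < n)%N.
    rewrite ltnNge; apply/negP => nm; apply: (@cut_high w t) cut_t.
      by rewrite (le_trans ni)// ler_exp2z// tE lerD2l; lia.
    by rewrite (le_trans nj)// ler_exp2z// tE lerD2l; lia.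
  rewrite (bigD1 (Ordinal mn))//= -tE indicE mem_set// mulr1.
  rewrite addrCA lerDl addr_ge0//; apply: sumr_ge0 => l _; exact: mulr_ge0.
rewrite lee_fin.
under eq_bigr => m _.
  have -> : 8 * 2 ^ (s + m%:Z) * (3 * La * (d i j / 2 ^ (s + m%:Z))) = 24 * La * d i j.
    by field; rewrite gt_eqF// exp2z_gt0.
  over.
rewrite sumr_const card_ord -mulr_natl.
have main : n%:R * (24 * La * d i j) <= 480 * ddim * ln Phi * d i j.
  have -> : n%:R * (24 * La * d i j) = 240 * ddim * d i j * (n%:R * ln 2).
    by rewrite /La; ring.
  have -> : 480 * ddim * ln Phi * d i j = 240 * ddim * d i j * (2 * ln Phi) by ring.
  by rewrite ler_wpM2l// !mulr_ge0// ?(le_trans _ ddim1)// ltW.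
have ln2 := ln2_ge.
have : 2^-1 * d i j <= ddim * ln Phi * d i j.
  rewrite ler_pM2r// -[leLHS]mul1r ler_pM//.
  exact: le_trans lnPhi.
by move: main sd; lra.
Qed.

End Distance.

End Embedding.

Unset Implicit Arguments.

Theorem theorem1p4 (R : realType) :
  exists (C : R) (d : measure_display) (Omega : measurableType d)
      (P : probability Omega R) (Y : metricType R)
      (A : online_algorithm Omega Y),
    ultrametric Y /\
    forall (X : metricType R) (x : nat -> X),
      (forall w : Omega,
         [/\ online_embedding x (run A x w),
             dominating x (run A x w) &
             forall k : nat, (0 < k)%N -> is_HST 2 (range (run A x w k))]) /\
      (forall (k : nat) (i j : 'I_k),
         let D := fun w : Omega => mdist (run A x w k i) (run A x w k j) in
         measurable_fun setT D /\
         forall ddim : R, has_doubling_dimension (prefix_set x k) ddim ->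
           ('E_P[D] <= (C * (ddim * ln (Num.max 2 (aspect_ratio (prefix_set x k))))
                        * mdist (x i) (x j))%:E)%E).
Proof.
exists 512, _, _, (unit_law R), (labeling_metric R), (@hst_algorithm R).
split; first exact: labeling_ultrametric.
move=> X x; split => [w|k i j D].
  split.
  - split => [k i j xij|k i]; first by rewrite !run_embed; exact: embed_eq.
    by rewrite !run_embed.
  - by move=> k i j; rewrite !run_embed; exact: embed_dominates.
  - by case=> // k _; exact: labeling_HST.
have -> : D = fun w => mdist (embed (fun a b => mdist (x a) (x b)) w i)
    (embed (fun a b => mdist (x a) (x b)) w j).
  by apply/funext => w; rewrite /D !run_embed.
(* A repeated point has the same image, so its distance is constantly [0]; the estimates above
   concern distinct points. *)
have [xij|/eqP xij] := eqVneq (x i) (x j); last first.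
  by split; [exact: distance_measurable|move=> ddim; exact: expected_distance].
rewrite (_ : (fun w => _) = cst 0); last first.
  by apply/funext => w; rewrite (embed_eq _ xij) mdistxx.
split; first exact: measurable_cst.
by move=> ddim _; rewrite expectation_cst xij mdistxx mulr0.
Qed.
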